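(* (i) The assignments $M\mapsto\mathcal B(M)$ on objects and $f\mapsto\mathcal X(f)$ on monomorphisms (the matchings induced by monomorphisms) define a functor $\mathcal X:(\mathbf{vect}^{\mathbf R})^{\hookrightarrow}\to\mathbf{Barc}^{\hookrightarrow}$. (ii) Dually, the assignments $M\mapsto\mathcal B(M)$ on objects and $f\mapsto\mathcal X(f)$ on epimorphisms (the matchings induced by epimorphisms) define a functor $\mathcal X:(\mathbf{vect}^{\mathbf R})^{\twoheadrightarrow}\to\mathbf{Barc}^{\twoheadrightarrow}$.
   Context: For a category $\mathbf C$, $\mathbf C^{\hookrightarrow}$ (resp. $\mathbf C^{\twoheadrightarrow}$) is the subcategory with the same objects and with morphisms the monomorphisms (resp. epimorphisms) of $\mathbf C$. Fix a field $K$. $\mathbf{vect}$ is the category of finite dimensional $K$-vector spaces, $\mathbf R$ the poset category of real numbers. A pointwise finite dimensional (p.f.d.) persistence module is an object of the functor category $\mathbf{vect}^{\mathbf R}$. An interval is a non-empty set $I\subseteq\mathbb R$ such that $a,c\in I$ and $a<b<c$ imply $b\in I$. A barcode is a multiset representation of intervals: a subset of $S\times X$ where $S$ is a set of intervals and $X$ is any set (of indices). An element $(I,x)$ is usually written simply $I$. A barcode is natural if $X=\mathbb N=\{1,2,\dots\}$ and for each $I$ the set of its indices is a prefix of $\mathbb N$. For a p.f.d. persistence module $M$, $\mathcal B(M)$ denotes the unique natural barcode with $M\cong\bigoplus_{I\in\mathcal B(M)}K^I$ (it exists by the structure theorem), where the interval module $K^I$ is $K$ at indices in $I$, $0$ elsewhere,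 with identity internal maps between indices in $I$. For intervals $I,J$: $I$ bounds $J$ above if for all $s\in J$ there is $t\in I$ with $s\le t$; $I$ and $J$ coincide above if each bounds the other above. $J$ bounds $I$ below if for all $t\in I$ there is $s\in J$ with $s\le t$; $I$ and $J$ coincide below if each bounds the other below. $I$ overlaps $J$ above if $I\cap J\neq\emptyset$, $I$ bounds $J$ above, and $J$ bounds $I$ below. An overlap matching $\sigma:\mathcal C\to\mathcal D$ of barcodes is a matching (partial injective function) such that $\sigma(I)=J$ implies that $I$ overlaps $J$ above. $\mathbf{Barc}$ is the category of barcodes and overlap matchings with composition $\tau\bullet\sigma=\{(I,K)\in\tau\circ\sigma\mid I\text{ overlaps }K\text{ above}\}$, where $\tau\circ\sigma$ is composition of relations. Induced matching of a monomorphism $f:M\hookrightarrow N$: coinciding above is an equivalence relation $\sim_a$ on intervals. For a class $e$, let $\mathcal B(M)^e$ be the set of elements of $\mathcal B(M)$ whose interval lies in $e$, totally ordered by $(I,n)<(J,n')$ if $I\supsetneq J$, or $I=J$ and $n<n'$; this is isomorphic to a prefix of $\mathbb N$. $\mathcal X(f):\mathcal B(M)\to\mathcal B(N)$ is the injection sending, for each class $e$, the $i$th element of $\mathcal B(M)^e$ to the $i$th element of $\mathcal B(N)^e$ (it is a fact that $|\mathcal B(M)^e|\le|\mathcal B(N)^e|$ for every $e$). Induced matching of an epimorphism $f:M\twoheadrightarrow N$: the dual construction, with $e$ ranging over the equivalence classes of intervals under coinciding below, with the same total orders on $\mathcal B(M)^e$ and $\mathcal B(N)^e$; here $|\mathcal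 B(N)^e|\le|\mathcal B(M)^e|$ and $\mathcal X(f)$ matches, for each $e$ and each $i\le|\mathcal B(N)^e|$, the $i$th element of $\mathcal B(M)^e$ with the $i$th element of $\mathcal B(N)^e$. *)

(* Defs.v *)
From HB Require Import structures.
From mathcomp Require Import all_boot all_order all_algebra.
From mathcomp Require Import boolp classical_sets functions cardinality reals.
From mathcomp Require Import num_normedtype.
Set Implicit Arguments.
Unset Strict Implicit.
Unset Printing Implicit Defensive.
Import Order.TTheory GRing.Theory Num.Theory.
Local Open Scope classical_set_scope.
Local Open Scope ring_scope.

Record category := Category {
  obj :> Type;
  mor : obj -> obj -> Type;
  idmor : forall x, mor x x;
  cmor : forall x y z, mor y z -> mor x y -> mor x z;
  cmor1m : forall x y (f : mor x y), cmor (idmor y) f = f;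
  cmorm1 : forall x y (f : mor x y), cmor f (idmor x) = f;
  cmorA : forall x y z w (h : mor z w) (g : mor y z) (f : mor x y),
    cmor h (cmor g f) = cmor (cmor h g) f }.

Arguments mor {c} _ _.
Arguments idmor {c} _.
Arguments cmor {c x y z} _ _.

Definition is_functor (C D : category) (F : C -> D)
    (Fm : forall x y : C, mor x y -> mor (F x) (F y)) : Prop :=
  (forall x, Fm x x (idmor x) = idmor (F x)) /\
  (forall x y z (g : mor y z) (f : mor x y),
     Fm x z (cmor g f) = cmor (Fm y z g) (Fm x y f)).

Record functor (C D : category) := Functor {
  fobj :> C -> D;
  fmor : forall x y : C, mor x y -> mor (fobj x) (fobj y);
  functorP : is_functor fmor }.

Arguments fmor {C D} _ {x y} _.

Lemma fmor1 (C D : category) (F : functor C D) (x : C) :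
  fmor F (idmor x) = idmor (F x).
Proof. by case: F => ? ? []. Qed.

Lemma fmorM (C D : category) (F : functor C D) (x y z : C)
  (g : mor y z) (f : mor x y) : fmor F (cmor g f) = cmor (fmor F g) (fmor F f).
Proof. by case: F => ? ? [] /=. Qed.

Section FunctorComposition.
Variables (C D E : category) (G : functor D E) (F : functor C D).

Lemma functor_comp_subproof :
  @is_functor C E (fun x => G (F x)) (fun x y f => fmor G (fmor F f)).
Proof. by split=> *; rewrite ?(fmor1, fmorM). Qed.

Definition functor_comp : functor C E := Functor functor_comp_subproof.

End FunctorComposition.

Record nattrans (C D : category) (F G : functor C D) := Nattrans {
  ncomp :> forall x : C, mor (F x) (G x);
  natural : forall (x y : C) (f : mor x y),
    cmor (ncomp y) (fmor F f) = cmor (fmor G f) (ncomp x) }.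

Lemma nattransP (C D : category) (F G : functor C D) (a b : nattrans F G) :
  (forall x, a x = b x) -> a = b.
Proof.
case: a => a Na; case: b => b Nb /= abE.
have ab : a = b by exact: functional_extensionality_dep.
by subst b; congr Nattrans; exact: Prop_irrelevance.
Qed.

Section FunctorCategory.
Variables C D : category.

Lemma nattrans_id_subproof (F : functor C D) (x y : C) (f : mor x y) :
  cmor (idmor (F y)) (fmor F f) = cmor (fmor F f) (idmor (F x)).
Proof. by rewrite cmor1m cmorm1. Qed.

Definition nattrans_id (F : functor C D) : nattrans F F :=
  Nattrans (@nattrans_id_subproof F).

Lemma nattrans_comp_subproof (F G H : functor C D) (b : nattrans G H)
    (a : nattrans F G) (x y : C) (f : mor x y) :
  cmor (cmor (b y) (a y)) (fmor F f) = cmor (fmor H f) (cmor (b x) (a x)).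
Proof. by rewrite -cmorA natural cmorA natural cmorA. Qed.

Definition nattrans_comp (F G H : functor C D) (b : nattrans G H)
  (a : nattrans F G) : nattrans F H := Nattrans (nattrans_comp_subproof b a).

Lemma nattrans_comp1m (F G : functor C D) (a : nattrans F G) :
  nattrans_comp (nattrans_id G) a = a.
Proof. by apply: nattransP => x; exact: cmor1m. Qed.

Lemma nattrans_compm1 (F G : functor C D) (a : nattrans F G) :
  nattrans_comp a (nattrans_id F) = a.
Proof. by apply: nattransP => x; exact: cmorm1. Qed.

Lemma nattrans_compA (F G H L : functor C D) (c : nattrans H L)
    (b : nattrans G H) (a : nattrans F G) :
  nattrans_comp c (nattrans_comp b a) = nattrans_comp (nattrans_comp c b) a.
Proof. by apply: nattransP => x; exact: cmorA. Qed.

Definition functor_cat : category :=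
  Category nattrans_comp1m nattrans_compm1 nattrans_compA.

End FunctorCategory.

Definition isomorphic (C : category) (x y : C) : Prop :=
  exists (f : mor x y) (g : mor y x),
    cmor g f = idmor x /\ cmor f g = idmor y.

Definition is_mono (C : category) (x y : C) (f : mor x y) : Prop :=
  forall (z : C) (g h : mor z x), cmor f g = cmor f h -> g = h.

Definition is_epi (C : category) (x y : C) (f : mor x y) : Prop :=
  forall (z : C) (g h : mor y z), cmor g f = cmor h f -> g = h.

Lemma sval_injective (T : Type) (P : T -> Prop) : injective (@sval T P).
Proof.
by case=> x Px [y Py] /= xy; subst y; congr exist; exact: Prop_irrelevance.
Qed.

Section MonoEpiSubcategories.
Variable C : category.

Lemma mono_id (x : C) : is_mono (idmor x).
Proof. by move=> z g h; rewrite !cmor1m. Qed.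

Lemma mono_comp (x y z : C) (g : mor y z) (f : mor x y) :
  is_mono g -> is_mono f -> is_mono (cmor g f).
Proof. by move=> gm fm w h k; rewrite -!cmorA => /gm /fm. Qed.

Lemma epi_id (x : C) : is_epi (idmor x).
Proof. by move=> z g h; rewrite !cmorm1. Qed.

Lemma epi_comp (x y z : C) (g : mor y z) (f : mor x y) :
  is_epi g -> is_epi f -> is_epi (cmor g f).
Proof. by move=> ge fe w h k; rewrite !cmorA => /fe /ge. Qed.

Definition monomor (x y : C) := {f : mor x y | is_mono f}.

Definition monomor_id (x : C) : monomor x x := exist _ (idmor x) (@mono_id x).

Definition monomor_comp (x y z : C) (g : monomor y z) (f : monomor x y) :
    monomor x z :=
  exist _ (cmor (sval g) (sval f)) (mono_comp (svalP g) (svalP f)).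

Lemma monomor_comp1m (x y : C) (f : monomor x y) :
  monomor_comp (monomor_id y) f = f.
Proof. by apply: sval_injective; exact: cmor1m. Qed.

Lemma monomor_compm1 (x y : C) (f : monomor x y) :
  monomor_comp f (monomor_id x) = f.
Proof. by apply: sval_injective; exact: cmorm1. Qed.

Lemma monomor_compA (x y z w : C) (h : monomor z w) (g : monomor y z)
    (f : monomor x y) :
  monomor_comp h (monomor_comp g f) = monomor_comp (monomor_comp h g) f.
Proof. by apply: sval_injective; exact: cmorA. Qed.

Definition mono_cat : category :=
  Category monomor_comp1m monomor_compm1 monomor_compA.

Definition epimor (x y : C) := {f : mor x y | is_epi f}.

Definition epimor_id (x : C) : epimor x x := exist _ (idmor x) (@epi_id x).

Definition epimor_comp (x y z : C) (g : epimor y z) (f : epimor x y) :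
    epimor x z :=
  exist _ (cmor (sval g) (sval f)) (epi_comp (svalP g) (svalP f)).

Lemma epimor_comp1m (x y : C) (f : epimor x y) :
  epimor_comp (epimor_id y) f = f.
Proof. by apply: sval_injective; exact: cmor1m. Qed.

Lemma epimor_compm1 (x y : C) (f : epimor x y) :
  epimor_comp f (epimor_id x) = f.
Proof. by apply: sval_injective; exact: cmorm1. Qed.

Lemma epimor_compA (x y z w : C) (h : epimor z w) (g : epimor y z)
    (f : epimor x y) :
  epimor_comp h (epimor_comp g f) = epimor_comp (epimor_comp h g) f.
Proof. by apply: sval_injective; exact: cmorA. Qed.

Definition epi_cat : category :=
  Category epimor_comp1m epimor_compm1 epimor_compA.

End MonoEpiSubcategories.

Section PosetCategory.
Variables (d : Order.disp_t) (P : porderType d).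

Definition poset_cat : category :=
  @Category P (fun x y => (x <= y)%O) (@lexx d P)
    (fun x y z yz xy => le_trans xy yz)
    (fun _ _ _ => bool_irrelevance _ _) (fun _ _ _ => bool_irrelevance _ _)
    (fun _ _ _ _ _ _ _ => bool_irrelevance _ _).

End PosetCategory.

Section VectorSpaces.
Variable K : fieldType.

Lemma linear_eqP (U V : lmodType K) (f g : {linear U -> V}) : f =1 g -> f = g.
Proof.
case: f => f [[f1] [f2]]; case: g => g [[g1] [g2]] /= fgE.
have fg : f = g by exact/funext.
by subst g; congr (GRing.Linear.Pack (GRing.Linear.Class _ _));
  congr (_ _); exact: Prop_irrelevance.
Qed.

Definition linear_id (U : lmodType K) : {linear U -> U} := idfun.
Definition linear_comp (U V W : lmodType K) (g : {linear V -> W})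
  (f : {linear U -> V}) : {linear U -> W} := g \o f.

Lemma linear_comp1m (U V : lmodType K) (f : {linear U -> V}) :
  linear_comp (linear_id V) f = f.
Proof. exact: linear_eqP. Qed.

Lemma linear_compm1 (U V : lmodType K) (f : {linear U -> V}) :
  linear_comp f (linear_id U) = f.
Proof. exact: linear_eqP. Qed.

Lemma linear_compA (U V W X : lmodType K) (h : {linear W -> X})
    (g : {linear V -> W}) (f : {linear U -> V}) :
  linear_comp h (linear_comp g f) = linear_comp (linear_comp h g) f.
Proof. exact: linear_eqP. Qed.

Definition Vect : category :=
  Category linear_comp1m linear_compm1 linear_compA.

Definition vect : category :=
  @Category (vectType K) (fun U V => 'Hom(U, V)) (fun U => \1%VF)
    (fun U V W g f => (g \o f)%VF)
    (fun U V => @comp_lfun1l _ U V) (fun U V => @comp_lfun1r _ U V)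
    (fun U V W X h g f => comp_lfunA h g f).

Definition vect_incl_mor (U V : vectType K) (f : 'Hom(U, V)) :
  {linear U -> V} := f.

Lemma vect_incl_subproof :
  @is_functor vect Vect (fun U : vectType K => U : lmodType K) vect_incl_mor.
Proof. by split=> *; apply: linear_eqP => x /=; rewrite lfunE. Qed.

Definition vect_incl : functor vect Vect := Functor vect_incl_subproof.

End VectorSpaces.

Section DirectSum.
Variables (K : fieldType) (T : Type).

Record dsum (V : T -> lmodType K) := Dsum {
  dsum_val :> forall i, V i;
  dsum_fin : finite_set [set i | dsum_val i != 0] }.

Lemma dsumP (V : T -> lmodType K) (x y : dsum V) :
  (forall i, x i = y i) -> x = y.
Proof.
case: x => x xf; case: y => y yf /= xyE.
have xy : x = y by exact: functional_extensionality_dep.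
by subst y; congr Dsum; exact: Prop_irrelevance.
Qed.

Section Module.
Variable V : T -> lmodType K.

HB.instance Definition _ := gen_eqMixin (dsum V).
HB.instance Definition _ := gen_choiceMixin (dsum V).

Lemma dsum0_fin : finite_set [set i | (0 : V i) != 0].
Proof.
rewrite (_ : [set i | _] = set0) ?finite_set0//.
by apply/seteqP; split=> i //=; rewrite eqxx.
Qed.

Lemma dsumN_fin (x : dsum V) : finite_set [set i | - x i != 0].
Proof.
by apply: sub_finite_set (dsum_fin x) => i /=; rewrite oppr_eq0.
Qed.

Lemma dsumD_fin (x y : dsum V) : finite_set [set i | x i + y i != 0].
Proof.
have fxy : finite_set ([set i | x i != 0] `|` [set i | y i != 0]).
  by rewrite finite_setU; split; exact: dsum_fin.
apply: sub_finite_set fxy => i /=.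
by have [->|] := eqVneq (x i) 0; [rewrite add0r; right | left].
Qed.

Lemma dsumZ_fin (a : K) (x : dsum V) : finite_set [set i | a *: x i != 0].
Proof.
apply: sub_finite_set (dsum_fin x) => i /=; apply: contra_neq => ->.
exact: scaler0.
Qed.

Definition dsum_add x y := Dsum (dsumD_fin x y).
Definition dsum_scale a x := Dsum (dsumZ_fin a x).

Let addA : associative dsum_add.
Proof. by move=> x y z; apply: dsumP => i; exact: addrA. Qed.
Let addC : commutative dsum_add.
Proof. by move=> x y; apply: dsumP => i; exact: addrC. Qed.
Let add0 : left_id (Dsum dsum0_fin) dsum_add.
Proof. by move=> x; apply: dsumP => i; exact: add0r. Qed.
Let addN : left_inverse (Dsum dsum0_fin) (fun x => Dsum (dsumN_fin x)) dsum_add.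
Proof. by move=> x; apply: dsumP => i; exact: addNr. Qed.

HB.instance Definition _ :=
  GRing.isZmodule.Build (dsum V) addA addC add0 addN.

Let scaleA a b x : dsum_scale a (dsum_scale b x) = dsum_scale (a * b) x.
Proof. by apply: dsumP => i; exact: scalerA. Qed.
Let scale1 : left_id 1 dsum_scale.
Proof. by move=> x; apply: dsumP => i; exact: scale1r. Qed.
Let scaleDr : right_distributive dsum_scale +%R.
Proof. by move=> a x y; apply: dsumP => i; exact: scalerDr. Qed.
Let scaleDl x : {morph dsum_scale^~ x : a b / a + b}.
Proof. by move=> a b; apply: dsumP => i; exact: scalerDl. Qed.

HB.instance Definition _ := GRing.Zmodule_isLmodule.Build K (dsum V)
  scaleA scale1 scaleDr scaleDl.

End Module.

Section Map.
Variables (U V : T -> lmodType K) (f : forall i, {linear U i -> V i}).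

Lemma dsum_map_fin (x : dsum U) : finite_set [set i | f i (x i) != 0].
Proof.
apply: sub_finite_set (dsum_fin x) => i /=; apply: contra_neq => ->.
exact: linear0.
Qed.

Definition dsum_map_fun (x : dsum U) : dsum V := Dsum (dsum_map_fin x).

Let dsum_map_linear : linear dsum_map_fun.
Proof. by move=> a x y; apply: dsumP => i; exact: linearP. Qed.

HB.instance Definition _ :=
  GRing.isLinear.Build K (dsum U) (dsum V) _ dsum_map_fun dsum_map_linear.

Definition dsum_map : {linear dsum U -> dsum V} := dsum_map_fun.

End Map.

Variables (C : category) (F : T -> functor C (Vect K)).

Lemma dsum_functor_subproof :
  @is_functor C (Vect K) (fun c => dsum (fun i => F i c) : lmodType K)
    (fun x y f => dsum_map (fun i => fmor (F i) f)).
Proof.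
split=> *; apply: linear_eqP => u; apply: dsumP => i /=.
  by rewrite fmor1.
by rewrite fmorM.
Qed.

Definition dsum_functor : functor C (Vect K) := Functor dsum_functor_subproof.

End DirectSum.

Section Intervals.
Variable R : realType.

Record ivl := Ivl {
  iset :> set R;
  ivl_neq0 : iset !=set0;
  ivl_itv : is_interval iset }.

(* I bounds J above *)
Definition bounds_above (I J : ivl) : Prop :=
  forall s, iset J s -> exists2 t, iset I t & s <= t.

Definition coincide_above (I J : ivl) : Prop :=
  bounds_above I J /\ bounds_above J I.

(* J bounds I below *)
Definition bounds_below (J I : ivl) : Prop :=
  forall t, iset I t -> exists2 s, iset J s & s <= t.

Definition coincide_below (I J : ivl) : Prop :=
  bounds_below I J /\ bounds_below J I.

Definition overlaps_above (I J : ivl) : Prop :=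
  [/\ (I : set R) `&` J !=set0, bounds_above I J & bounds_below J I].

Record barcode := Barcode {
  bc_index : Type;
  bc_set : set (ivl * bc_index) }.

Definition bc_elt (B : barcode) := {b : ivl * bc_index B | bc_set b}.
Coercion bc_elt : barcode >-> Sortclass.

Definition bc_ivl (B : barcode) (b : B) : ivl := (sval b).1.

Record overlap_matching (C D : barcode) := OverlapMatching {
  omrel :> C -> D -> Prop;
  om_functional : forall c d d', omrel c d -> omrel c d' -> d = d';
  om_injective : forall c c' d, omrel c d -> omrel c' d -> c = c';
  om_overlap : forall c d, omrel c d -> overlaps_above (bc_ivl c) (bc_ivl d) }.

Lemma overlap_matchingP (C D : barcode) (s t : overlap_matching C D) :
  (forall c d, s c d <-> t c d) -> s = t.
Proof.
case: s => s s1 s2 s3; case: t => t t1 t2 t3 /= stE.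
have st : s = t by apply/funext => c; apply/funext => d; exact/propext.
by subst t; congr OverlapMatching; exact: Prop_irrelevance.
Qed.

Lemma overlaps_above_refl (I : ivl) : overlaps_above I I.
Proof.
split; last 2 first.
- by move=> s Is; exists s.
- by move=> s Is; exists s.
by rewrite setIid; exact: ivl_neq0.
Qed.

Lemma overlaps_above_mid (I J L M : ivl) :
  overlaps_above I J -> overlaps_above J L -> overlaps_above L M ->
  overlaps_above I M -> overlaps_above I L /\ overlaps_above J M.
Proof.
move=> [_ IJa JIb] [_ JLa LJb] [_ LMa MLb] [[x [Ix Mx]] _ _].
have JMa : bounds_above J M.
  move=> s /LMa[t Lt st]; have [u Ju tu] := JLa _ Lt.
  by exists u => //; exact: le_trans tu.
have MJb : bounds_below M J.
  move=> s /LJb[t Lt st]; have [u Mu tu] := MLb _ Lt.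
  by exists u => //; exact: le_trans st.
have ILa : bounds_above I L.
  move=> s /JLa[t Jt st]; have [u Iu tu] := IJa _ Jt.
  by exists u => //; exact: le_trans tu.
have LIb : bounds_below L I.
  move=> s /JIb[t Jt st]; have [u Lu tu] := LJb _ Jt.
  by exists u => //; exact: le_trans st.
split; split=> //; exists x; split=> //.
- have [t Lt xt] := LMa _ Mx; have [u Lu ux] := LIb _ Ix.
  by apply: (ivl_itv Lu Lt); rewrite ux xt.
- have [t Jt xt] := JMa _ Mx; have [u Ju ux] := JIb _ Ix.
  by apply: (ivl_itv Ju Jt); rewrite ux xt.
Qed.

Section Matchings.

Lemma om_id_fun (C : barcode) (c d d' : C) : c = d -> c = d' -> d = d'.
Proof. by move=> -> ->. Qed.

Lemma om_id_inj (C : barcode) (c c' d : C) : c = d -> c' = d -> c = c'.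
Proof. by move=> -> ->. Qed.

Lemma om_id_overlap (C : barcode) (c d : C) :
  c = d -> overlaps_above (bc_ivl c) (bc_ivl d).
Proof. by move=> ->; exact: overlaps_above_refl. Qed.

Definition om_id (C : barcode) : overlap_matching C C :=
  OverlapMatching (@om_id_fun C) (@om_id_inj C) (@om_id_overlap C).

Variables (C D E : barcode) (t : overlap_matching D E)
  (s : overlap_matching C D).

Definition om_comp_rel (c : C) (e : E) : Prop :=
  (exists d, s c d /\ t d e) /\ overlaps_above (bc_ivl c) (bc_ivl e).

Lemma om_comp_fun c e e' : om_comp_rel c e -> om_comp_rel c e' -> e = e'.
Proof.
move=> [[d [cd de]] _] [[d' [cd' de']] _].
by rewrite -(om_functional cd cd') in de'; exact: om_functional de de'.
Qed.

Lemma om_comp_inj c c' e : om_comp_rel c e -> om_comp_rel c' e -> c = c'.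
Proof.
move=> [[d [cd de]] _] [[d' [cd' de']] _].
by rewrite -(om_injective de de') in cd'; exact: om_injective cd cd'.
Qed.

Lemma om_comp_overlap c e :
  om_comp_rel c e -> overlaps_above (bc_ivl c) (bc_ivl e).
Proof. by case. Qed.

Definition om_comp : overlap_matching C E :=
  OverlapMatching om_comp_fun om_comp_inj om_comp_overlap.

End Matchings.

Lemma om_comp1m (C D : barcode) (s : overlap_matching C D) :
  om_comp (om_id D) s = s.
Proof.
apply: overlap_matchingP => c d; split=> [[[d' [cd' <-]] _]//|cd].
by split; [exists d | exact: om_overlap cd].
Qed.

Lemma om_compm1 (C D : barcode) (s : overlap_matching C D) :
  om_comp s (om_id C) = s.
Proof.
apply: overlap_matchingP => c d; split=> [[[d' [-> cd']] _]//|cd].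
by split; [exists c | exact: om_overlap cd].
Qed.

Lemma om_compA (A B C D : barcode) (u : overlap_matching C D)
    (t : overlap_matching B C) (s : overlap_matching A B) :
  om_comp u (om_comp t s) = om_comp (om_comp u t) s.
Proof.
apply: overlap_matchingP => a d; split.
- move=> [[c [[[b [ab bc]] ac] cd]] ad].
  have [_ bd] := overlaps_above_mid (om_overlap ab) (om_overlap bc)
    (om_overlap cd) ad.
  by split=> //; exists b; split=> //; split=> //; exists c.
- move=> [[b [ab [[c [bc cd]] bd]]] ad].
  have [ac _] := overlaps_above_mid (om_overlap ab) (om_overlap bc)
    (om_overlap cd) ad.
  by split=> //; exists c; split=> //; split=> //; exists b.
Qed.

Definition Barc : category := Category om_comp1m om_compm1 om_compA.

End Intervals.

Section PersistenceModules.
Variables (R : realType) (K : fieldType).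

Definition pfdmod : category := functor_cat (poset_cat R) (vect K).

Section IntervalModule.
Variable I : ivl R.

(* Row vectors of length 1 (that is, K) if t \in I, of length 0 otherwise;
   pid_mx 1 is the identity between indices in I. *)
Definition ivlmod_obj (t : R) : vectType K := 'rV[K]_(`[< iset I t >]).

Definition ivlmod_mor (s t : R) (st : s <= t) :
    'Hom(ivlmod_obj s, ivlmod_obj t) :=
  linfun (mulmxr (pid_mx 1 : 'M_(`[< iset I s >], `[< iset I t >]))).

Lemma rv_pid_mx1 (b : bool) (x : 'rV[K]_b) : x *m pid_mx 1 = x.
Proof.
by case: b x => x; [rewrite pid_mx_1 mulmx1 | rewrite [LHS]thinmx0 thinmx0].
Qed.

Lemma rv_pid_mx1_comp (a b c : bool) (x : 'rV[K]_a) : (a -> c -> b) ->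
  x *m (pid_mx 1 : 'M_(a, b)) *m (pid_mx 1 : 'M_(b, c)) = x *m pid_mx 1.
Proof.
rewrite -mulmxA mul_pid_mx.
case: a x => x; last by rewrite thinmx0 !mul0mx.
case: c; last by rewrite [LHS]thinmx0 thinmx0.
by move=> /(_ isT isT) ->.
Qed.

Lemma ivlmod_subproof :
  @is_functor (poset_cat R) (vect K) ivlmod_obj ivlmod_mor.
Proof.
split=> [t|s t u tu st]; apply/lfunP => x.
  by rewrite id_lfunE lfunE; exact: rv_pid_mx1.
rewrite comp_lfunE !lfunE; apply/esym/rv_pid_mx1_comp => /asboolP Is /asboolP Iu.
by apply/asboolP; apply: (ivl_itv Is Iu); rewrite st.
Qed.

Definition ivlmod : functor (poset_cat R) (vect K) := Functor ivlmod_subproof.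

End IntervalModule.

(* The indices of each interval form a prefix of nat, which starts at 0 here. *)
Definition is_natural (B : set (ivl R * nat)) : Prop :=
  forall I m n, (m <= n)%N -> B (I, n) -> B (I, m).

Definition decomposes (M : pfdmod) (B : set (ivl R * nat)) : Prop :=
  @isomorphic (functor_cat (poset_cat R) (Vect K))
    (functor_comp (vect_incl K) M)
    (dsum_functor (fun b : Barcode B =>
       functor_comp (vect_incl K) (ivlmod (bc_ivl b)))).

(* The structure theorem provides a unique B with the required property; the
   default value set0 is never used. *)
Definition bars (M : pfdmod) : set (ivl R * nat) :=
  xget set0 [set B | is_natural B /\ decomposes M B].

Definition barc (M : pfdmod) : barcode R := Barcode (bars M).

Definition elt_lt (M : pfdmod) (b b' : barc M) : Prop :=
  let: (J, m) := sval b in let: (L, n) := sval b' in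
  iset L `<` iset J \/ J = L /\ (m < n)%N.

Definition class_elts (M : pfdmod) (e : set (ivl R)) : set (barc M) :=
  [set b | e (bc_ivl b)].

(* The i-th element (from 0) of a class is the one with exactly i predecessors
   in that class. *)
Definition is_nth (M : pfdmod) (e : set (ivl R)) (i : nat) (b : barc M) : Prop :=
  class_elts e b /\ ([set c | class_elts e c /\ elt_lt c b] #= `I_i)%card.

Definition is_class (r : ivl R -> ivl R -> Prop) (e : set (ivl R)) : Prop :=
  exists J, e = [set L | r J L].

Definition induced_by (r : ivl R -> ivl R -> Prop) (M N : pfdmod)
    (b : barc M) (c : barc N) : Prop :=
  exists (e : set (ivl R)) (i : nat),
    [/\ is_class r e, is_nth e i b & is_nth e i c].

(* The induced matching depends on f only through its source and target. *)
Definition induced_mono (M N : mono_cat pfdmod) (f : mor M N) :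
  barc M -> barc N -> Prop := @induced_by (@coincide_above R) M N.

Definition induced_epi (M N : epi_cat pfdmod) (f : mor M N) :
  barc M -> barc N -> Prop := @induced_by (@coincide_below R) M N.

End PersistenceModules.

(* Main.v *)
(* The essential points are the structure theorem and two rank inequalities.

   A split interval summand of a nonzero p.f.d. module V is found as follows.
   Fix t0 with V t0 <> 0 and let G be the smallest nonzero kernel of the maps
   V t0 -> V u, and x a vector of G that lies in every image of V s -> V t0
   meeting G. Then x generates an interval summand over the set of those s and
   of the u for which V t0 -> V u is injective: x is lifted to the left, and a
   functional dual to x is extended to the right, by linear compactness.
   Families of such summands that are pairwise biorthogonal are closed under
   unions of chains; in a maximal one the common kernel of the functionals is
   zero, since otherwise another summand splits off. Pointwise finiteness turns
   such a family into an isomorphism with a direct sum of interval modules.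

   In a decomposition, the rank of M s -> M t counts the intervals containing s
   and t. Hence the number of intervals J containing I and coinciding above
   with I is, for suitable s, t in I and u > I, the dimension of
   im (M s -> M t) `&` ker (M t -> M u), which is monotone under
   monomorphisms; dually for epimorphisms. So the i-th element of a class is
   matched with a larger interval of the same class, and such a pair overlaps.
   This also makes the truncation in the composition of matchings harmless. *)

From HB Require Import structures.
Require Import Defs.
From mathcomp Require Import all_boot all_order all_algebra reals.
From mathcomp Require Import finmap boolp classical_sets functions cardinality.
From mathcomp Require Import num_normedtype zify.
Set Implicit Arguments.
Unset Strict Implicit.
Unset Printing Implicit Defensive.
Import Order.TTheory GRing.Theory Num.Theory.
Local Open Scope classical_set_scope.
Local Open Scope ring_scope.

(** * Linear algebra and linear compactness *)

Lemma dependent_choice (T : Type) (U : T -> Type) (P : forall i, U i -> Prop) :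
  (forall i, exists x, P i x) -> exists f : forall i, U i, forall i, P i (f i).
Proof. by move=> Pex; exists (fun i => sval (cid (Pex i))) => i; case: cid. Qed.

Lemma exists_minimizer (T : Type) (P : set T) (mu : T -> nat) :
  P !=set0 -> exists2 x, P x & forall y, P y -> (mu x <= mu y)%N.
Proof.
move=> [x0 Px0].
have exn : exists n, `[< exists2 x, P x & mu x = n >].
  by exists (mu x0); apply/asboolP; exists x0.
case: (ex_minnP exn) => n /asboolP[x Px <-] min_x.
by exists x => // y Py; apply: min_x; apply/asboolP; exists y.
Qed.

Definition lfun_of (K : fieldType) (U V : vectType K) (f : U -> V)
    (flin : linear f) : 'Hom(U, V) :=
  linfun (HB.pack f (GRing.isLinear.Build K U V _ f flin) : {linear U -> V}).

Lemma lfun_ofE (K : fieldType) (U V : vectType K) (f : U -> V)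
  (flin : linear f) x : lfun_of flin x = f x.
Proof. by rewrite lfunE. Qed.

Section LinearAlgebra.
Variables (K : fieldType) (V : vectType K).

(** A member of least dimension is the smallest one: a member of the chain inside it has the same
    dimension, hence equals it. *)
Lemma vspace_chain_min (P : set {vspace V}) : P !=set0 ->
    (forall U W, P U -> P W -> (U <= W)%VS \/ (W <= U)%VS) ->
  exists2 U, P U & forall W, P W -> (U <= W)%VS.
Proof.
move=> /(exists_minimizer (fun U => \dim U))[U PU Umin] Ptot.
exists U => // W PW; have [//|WU] := Ptot _ _ PU PW.
by rewrite -(eqP (_ : W == U)) ?subvv// eqEdim WU Umin.
Qed.

Lemma vspace_chain_max (P : set {vspace V}) : P !=set0 ->
    (forall U W, P U -> P W -> (U <= W)%VS \/ (W <= U)%VS) ->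
  exists2 U, P U & forall W, P W -> (W <= U)%VS.
Proof.
move=> /(exists_minimizer (fun U => \dim {:V} - \dim U)%N)[U PU Umin] Ptot.
exists U => // W PW; have [UW|//] := Ptot _ _ PU PW.
rewrite -(eqP (_ : U == W)) ?subvv// eqEdim UW.
by have := Umin _ PW; rewrite leq_sub2lE// dimvS ?subvf.
Qed.

(** The component of [x] off [E] is nonzero, so one of its coordinates is. That coordinate, taken
    after subtracting the projection onto [E] and normalised at [x], is the functional. *)
Lemma exists_functional (E : {vspace V}) (x : V) : x \notin E ->
  exists2 phi : 'Hom(V, K^o), phi x = 1 & forall y, y \in E -> phi y = 0.
Proof.
move=> xE; set z := x - projv E x; pose e := vbasis {:V}.
have [j zj0] : exists j, coord e j z != 0.
  apply/existsP; apply: contraNT xE => /existsPn zE.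
  rewrite -[x](subrK (projv E x)) -/z (coord_vbasis (memvf z)).
  rewrite big1 ?add0r ?memv_proj// => j _.
  by rewrite (eqP (negPn (zE j))) scale0r.
pose g y : K^o := (coord e j z)^-1 * coord e j (y - projv E y).
have glin : linear g.
  move=> a u v; rewrite /g linearP opprD addrACA -scalerBr linearP.
  by rewrite mulrDr mulrCA.
exists (lfun_of glin) => [|y yE]; rewrite lfun_ofE /g; first exact: mulVf.
by rewrite projv_id// subrr linear0 mulr0.
Qed.

(** A coset of a subspace. The empty set is excluded, so that the least member of a chain has a
    point. *)
Definition affine (A : set V) :=
  exists x (W : {vspace V}), A = [set y | y - x \in W].

Lemma affine_point (A : set V) : affine A -> A !=set0.
Proof. by move=> [x [W ->]]; exists x; rewrite /= subrr mem0v. Qed.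

Lemma affine_center (A : set V) x : affine A -> A x ->
  exists W : {vspace V}, A = [set y | y - x \in W].
Proof.
move=> [z [W ->]] /= xzW; exists W; apply/seteqP; split=> y /= yW.
  by rewrite -(subrKA z) -[z - x]opprB rpredB.
by rewrite -(subrKA x) rpredD.
Qed.

(** A member whose direction has least dimension is the smallest one. It and any member inside it
    are recentred at a common point; the two directions are then nested and have the same
    dimension. *)
Lemma affine_chain_min (P : set (set V)) : P !=set0 ->
    (forall A, P A -> affine A) ->
    (forall A B, P A -> P B -> A `<=` B \/ B `<=` A) ->
  exists2 A, P A & forall B, P B -> A `<=` B.
Proof.
move=> [A0 PA0] Paff Ptot.
pose Q (W : {vspace V}) := exists x, P [set y | y - x \in W].
have [|W [x Px] Wmin] := @exists_minimizer _ Q (fun W => \dim W).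
  by have [x [W A0E]] := Paff _ PA0; exists W, x; rewrite -A0E.
exists [set y | y - x \in W] => // B PB; have [//|BA] := Ptot _ _ Px PB.
have [z Bz] := affine_point (Paff _ PB).
have [W' BE] := affine_center (Paff _ PB) Bz.
have [W'' AE] := affine_center (Paff _ Px) (BA _ Bz).
have WW'' : \dim W = \dim W''.
  apply/eqP; rewrite eqn_leq (Wmin W''); last by exists z; rewrite -AE.
  apply: dimvS; apply/subvP => v vW''; have : [set y | y - x \in W] (v + z).
    by rewrite AE /= addrK.
  have /= zx := BA _ Bz; move=> /= vzx.
  by rewrite -[v](addrK (z - x)) rpredB// addrA.
have W'W'' : (W' <= W'')%VS.
  apply/subvP => v vW'; have : B (v + z) by rewrite BE /= addrK.
  by move=> /BA; rewrite AE /= addrK.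
rewrite AE BE => y /=.
rewrite (eqP (_ : W'' == W'))// eq_sym eqEdim W'W'' -WW''.
by apply: Wmin; exists z; rewrite -BE.
Qed.

End LinearAlgebra.

Lemma affine_image (K : fieldType) (U V : vectType K) (f : 'Hom(U, V))
  (A : set U) : affine A -> affine (f @` A).
Proof.
move=> [x [W ->]]; exists (f x), (f @: W)%VS; apply/seteqP; split=> y /=.
  by move=> [u uW <-]; rewrite -linearB memv_img.
move=> /memv_imgP[w wW fwE]; exists (w + x); rewrite ?addrK//.
by rewrite linearD /= -fwE subrK.
Qed.

Lemma affine_fiber (K : fieldType) (U V : vectType K) (f : 'Hom(U, V))
  (A : set U) x : affine A -> A x -> affine [set y | A y /\ f y = f x].
Proof.
move=> affA Ax; have [W ->] := affine_center affA Ax.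
exists x, (W :&: lker f)%VS; apply/seteqP; split=> y /=.
  by move=> [yW fyx]; rewrite memv_cap yW memv_ker linearB /= fyx subrr eqxx.
by rewrite memv_cap memv_ker linearB subr_eq0 => /andP[-> /eqP].
Qed.

(* Linear compactness: a minimal subsystem of nonempty affine spaces has
   surjective transition maps, and then consists of singletons. *)
Section InverseLimit.
Variables (K : fieldType) (T : Type) (le : T -> T -> Prop).
Hypothesis le_refl : forall i, le i i.
Hypothesis le_tr : forall i j k, le i j -> le j k -> le i k.
Hypothesis le_tot : forall i j, le i j \/ le j i.
Variables (V : T -> vectType K) (p : forall i j, 'Hom(V i, V j)).
Hypothesis p_id : forall i v, p i i v = v.
Hypothesis p_comp : forall i j k v, le i j -> le j k ->
  p j k (p i j v) = p i k v.
Variable A : forall i, set (V i).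
Hypothesis affA : forall i, affine (@A i).
Hypothesis pA : forall i j v, le i j -> A v -> A (p i j v).

Let system (B : forall i, set (V i)) :=
  [/\ forall i, affine (B i), forall i j v, le i j -> B i v -> B j (p i j v)
    & forall i, B i `<=` @A i].

Lemma inverse_limit_inhabited : exists x : forall i, V i,
  (forall i, A (x i)) /\ (forall i j, le i j -> p i j (x i) = x j).
Proof.
pose S := {B | system B}.
(* [R] is reversed inclusion: what Zorn's lemma finds is a minimal subsystem. *)
pose R (s t : S) := `[< forall i, sval t i `<=` sval s i >].
have [||||[B Bsys] Bmin] := @Zorn S R.
- by move=> s; apply/asboolP => i v.
- move=> r s t /asboolP sr /asboolP ts; apply/asboolP => i v tv.
  exact: sr (ts _ _ tv).
- move=> s t /asboolP ts /asboolP st; apply: sval_injective.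
  apply: functional_extensionality_dep => i.
  by apply/seteqP; split=> v; [exact: st|exact: ts].
- move=> F Ftot.
  (* At each index the chain has a smallest member; [@A i] is added so that the empty chain is
     covered too. *)
  pose P i : set (set (V i)) :=
    [set C | C = @A i \/ exists2 s, F s & C = sval s i].
  have Pmin i : exists C, P i C /\ forall C', P i C' -> C `<=` C'.
    apply/exists2P; apply: affine_chain_min; first by exists (@A i); left.
      by move=> _ [->//|[s _ ->]]; case: (svalP s).
    move=> _ _ [->|[s Fs ->]] [->|[t Ft ->]].
    + by left.
    + by right; case: (svalP t) => _ _; exact.
    + by left; case: (svalP s) => _ _; exact.
    + have [/asboolP ts|/asboolP st] := Ftot _ _ Fs Ft.
        by right; exact: ts.
      by left; exact: st.
  have [C PC] := dependent_choice Pmin.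
  have CA i : C i `<=` @A i by apply: (PC i).2; left.
  have Csys : system C.
    split=> // [i|i j v ij Cv].
      by have [[->//|[s _ ->]] _] := PC i; case: (svalP s).
    have [[->|[s Fs ->]] _] := PC j; first exact: pA (CA _ _ Cv).
    case: (svalP s) => _ ps _; apply: ps => //.
    by apply: (PC i).2 Cv; right; exists s.
  exists (exist _ C Csys) => s Fs; apply/asboolP => i.
  by apply: (PC i).2; right; exists s.
have [affB pB BA] := Bsys.
have {}Bmin C : system C -> (forall i, C i `<=` B i) -> forall i, C i = B i.
  move=> Csys CB i; have CBE : exist _ C Csys = exist _ B Bsys :> S.
    by apply: Bmin; apply/asboolP.
  by have /= -> := congr1 sval CBE.
(* The smallest image at each index defines a subsystem, which by minimality is all of [B]. *)
have Bsurj i j : le i j -> B j `<=` p i j @` B i.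
  pose P j := [set C | exists2 i, le i j & C = p i j @` B i].
  have Pmin k : exists C, P k C /\ forall C', P k C' -> C `<=` C'.
    apply/exists2P; apply: affine_chain_min.
    - by exists (p k k @` B k), k.
    - by move=> _ [l _ ->]; exact: affine_image.
    - have sub l m : le l m -> le m k -> p l k @` B l `<=` p m k @` B m.
        move=> lm mk _ [v Bv <-]; exists (p l m v); first exact: pB.
        exact: p_comp.
      move=> _ _ [l lk ->] [m mk ->].
      by have [lm|ml] := le_tot l m; [left|right]; exact: sub.
  have [C PC] := dependent_choice Pmin.
  have CB k : C k `<=` B k.
    have /(PC k).2 Ck : P k (p k k @` B k) by exists k.
    by move=> v /Ck[w Bw <-]; rewrite p_id.
  have Csys : system C.
    split=> [k|k l v kl Cv|k v /CB/BA//].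
      by have [[l _ ->] _] := PC k; exact: affine_image.
    have [[m ml ->] _] := PC l; have [mk|km] := le_tot m k.
      have /(_ _ Cv)[w Bw <-] : C k `<=` p m k @` B m.
        by apply: (PC k).2; exists m.
      by exists w => //; rewrite p_comp.
    exists (p k m v); first exact/pB/CB.
    exact: p_comp.
  move=> ij; rewrite -(Bmin _ Csys CB); apply: (PC j).2; by exists i.
(* Prescribing the value [v] at index [i] cuts out a subsystem, nonempty by surjectivity. By
   minimality it is all of [B], so [w] equals [v]. Indices not below [i] are left unconstrained. *)
have Bsing i v w : B i v -> B i w -> v = w.
  move=> Bv; pose C j : set (V j) :=
    [set u | B j u /\ (le j i -> p j i u = p i i v)].
  have CE j : ~ le j i -> C j = B j.
    by move=> ji; apply/seteqP; split=> [u []//|u Bu]; split.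
  have Csys : system C.
    split=> [j|j k u jk [Bu uv]|j u [/BA]//]; last first.
      by split; [exact: pB|move=> ki; rewrite p_comp// uv//; exact: le_tr ki].
    have [ji|/CE->//] := pselect (le j i).
    have [u Bu uE] := Bsurj _ _ ji _ Bv.
    rewrite (_ : C j = [set w | B j w /\ p j i w = p j i u]).
      exact: affine_fiber.
    rewrite uE -[in RHS](p_id v).
    by apply/seteqP; split=> x [Bx xv]; split=> //; exact: xv.
  rewrite -(Bmin C Csys) => [|j u []//] [_ /(_ (le_refl i))].
  by rewrite !p_id.
have [x Bx] := dependent_choice (fun i => affine_point (affB i)).
exists x; split=> [i|i j ij]; first exact/BA/Bx.
by apply: Bsing; [apply: pB ij (Bx i)|exact: Bx].
Qed.

End InverseLimit.

(** * Splitting off an interval *)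

Section PersistenceModules.
Variables (R : realType) (K : fieldType).

(** The transition maps are given for all pairs of indices and constrained only for [s <= t], so
    that terms carry no order proofs. *)
Record pmod := Pmod {
  pobj :> R -> vectType K;
  pmor : forall s t, 'Hom(pobj s, pobj t);
  pmor1 : forall s v, pmor s s v = v;
  pmorM : forall s t u v, s <= t -> t <= u ->
    pmor t u (pmor s t v) = pmor s u v }.

(* A split interval summand: [bar_vec] is the inclusion and [bar_fun] the
   retraction, both extended by zero outside the interval. *)
Record bar (V : pmod) := Bar {
  bar_ivl : ivl R;
  bar_vec : forall t, V t;
  bar_fun : forall t, 'Hom(V t, K^o);
  bar_vec_out : forall t, ~ iset bar_ivl t -> bar_vec t = 0;
  bar_fun_out : forall t, ~ iset bar_ivl t -> bar_fun t = 0;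
  bar_vecP : forall s t, s <= t -> iset bar_ivl s ->
    pmor V s t (bar_vec s) = bar_vec t;
  bar_funP : forall s t v, s <= t -> iset bar_ivl t ->
    bar_fun t (pmor V s t v) = bar_fun s v;
  bar_norm : forall t, iset bar_ivl t -> bar_fun t (bar_vec t) = 1 }.

Section SplitOff.
Variables (V : pmod) (t0 : R).

Lemma lker_pmorS u w : t0 <= u -> u <= w ->
  (lker (pmor V t0 u) <= lker (pmor V t0 w))%VS.
Proof.
move=> t0u uw; apply/subvP => v; rewrite !memv_ker => /eqP v0.
by rewrite -(pmorM v t0u uw) v0 linear0.
Qed.

Lemma limg_pmorS r s : r <= s -> s <= t0 ->
  (limg (pmor V r t0) <= limg (pmor V s t0))%VS.
Proof.
move=> rs st0; apply/subvP => _ /memv_imgP[v _ ->].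
by rewrite -(pmorM v rs st0) memv_img ?memvf.
Qed.

Lemma exists_bar_at (v : V t0) : v != 0 -> inhabited (bar V).
Proof.
move=> v0.
have [G [Gneq0 Gker]] : exists G : {vspace V t0}, G != 0%VS /\
    forall u, t0 <= u -> lker (pmor V t0 u) != 0%VS ->
      (G <= lker (pmor V t0 u))%VS.
  (* The whole space serves when every kernel vanishes; it is nonzero because it contains [v]. *)
  pose P := [set G : {vspace V t0} | G = fullv \/
    exists u, [/\ t0 <= u, lker (pmor V t0 u) != 0%VS &
      G = lker (pmor V t0 u)]].
  have [||G PG Gmin] := @vspace_chain_min _ _ P.
  - by exists fullv; left.
  - move=> _ _ [->|[u [t0u _ ->]]] [->|[w [t0w _ ->]]]; rewrite ?subvf; auto.
    by have [uw|/ltW wu] := leP u w; [left|right]; exact: lker_pmorS.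
  exists G; split=> [|u t0u ku].
    case: PG => [->|[u [_ ? ->]]//]; apply: contraNneq v0 => full0.
    by rewrite -memv0 -full0 memvf.
  by apply: Gmin; right; exists u.
(* The summand will live on [L] to the left of [t0] and on [U] to the right. *)
pose L s := (s <= t0) && ((limg (pmor V s t0) :&: G)%VS != 0%VS).
pose U u := (t0 <= u) && (lker (pmor V t0 u) == 0%VS).
have Lt0 : L t0.
  rewrite /L lexx/=; suff -> : limg (pmor V t0 t0) = fullv by rewrite capfv.
  apply/eqP; rewrite eqEsubv subvf; apply/subvP => w _.
  by rewrite -(pmor1 w) memv_img ?memvf.
have Ut0 : U t0.
  rewrite /U lexx/=; apply/lker0P => w w'; by rewrite !pmor1.
have LS r s : L r -> r <= s -> s <= t0 -> L s.
  move=> /andP[_ Lr] rs st0; rewrite /L st0/=; apply: contra_neq Lr => s0.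
  by apply/eqP; rewrite -subv0 -s0 capvS// limg_pmorS.
have US u w : U w -> t0 <= u -> u <= w -> U u.
  move=> /andP[_ /eqP w0] t0u uw; rewrite /U t0u/= -subv0 -w0.
  exact: lker_pmorS.
have [x [x0 xG xL]] : exists x : V t0, [/\ x != 0, x \in G &
    forall s, L s -> x \in limg (pmor V s t0)].
  (* The traces of the images on [G] form a chain of nonzero spaces; [x] is a nonzero vector of the
     smallest one. *)
  pose P := [set H : {vspace V t0} | exists2 s, L s &
    H = (limg (pmor V s t0) :&: G)%VS].
  have [||_ [s /andP[_ Ls] ->] Hmin] := @vspace_chain_min _ _ P.
  - by exists (limg (pmor V t0 t0) :&: G)%VS, t0.
  - move=> _ _ [r Lr ->] [s Ls ->].
    have [rs|/ltW sr] := leP r s; [left|right]; apply: capvS => //;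
      apply: limg_pmorS => //; by [case/andP: Lr|case/andP: Ls].
  exists (vpick (limg (pmor V s t0) :&: G)); split.
  - by rewrite vpick0.
  - have := memv_pick (limg (pmor V s t0) :&: G).
    by rewrite memv_cap => /andP[].
  - move=> r Lr; apply: (subvP (subv_trans (Hmin _ _) (capvSl _ G))).
      by exists r.
    exact: memv_pick.
have [phi phix phiL] : exists2 phi : 'Hom(V t0, K^o), phi x = 1 &
    forall s w, s <= t0 -> ~~ L s -> phi (pmor V s t0 w) = 0.
  (* Images from indices outside [L] meet [G] only in 0, so [x] is not in the largest of them. The
     zero space is added in case there is none. *)
  pose P := [set E : {vspace V t0} | E = 0%VS \/
    exists s, [/\ s <= t0, ~~ L s & E = limg (pmor V s t0)]].
  have [||E PE Emax] := @vspace_chain_max _ _ P.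
  - by exists 0%VS; left.
  - move=> _ _ [->|[r [rt0 _ ->]]] [->|[s [st0 _ ->]]]; rewrite ?sub0v; auto.
    by have [rs|/ltW sr] := leP r s; [left|right]; exact: limg_pmorS.
  have xE : x \notin E.
    apply: contra x0 => xE; case: PE => [E0|[s [st0 Ls EE]]].
      by rewrite -memv0 -E0.
    move: Ls; rewrite /L st0 negbK => /eqP LG.
    by rewrite -memv0 -LG memv_cap -EE xE.
  have [phi phix phiE] := exists_functional xE.
  exists phi => // s w st0 Ls; apply/phiE/(subvP (Emax _ _)).
    by right; exists s.
  by rewrite memv_img ?memvf.
(* Lifting to the left: the fibres over [x] are nonempty affine spaces, because [x] lies in every
   image indexed by [L]. *)
have [y [yx yP]] : exists y : forall s : {s | L s}, V (sval s),
    (forall s, pmor V (sval s) t0 (y s) = x) /\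
    (forall r s, sval r <= sval s ->
      pmor V (sval r) (sval s) (y r) = y s).
  apply: (@inverse_limit_inhabited K _ (fun r s => sval r <= sval s)
    _ _ _ (fun s : {s | L s} => V (sval s))
    (fun r s => pmor V (sval r) (sval s)) _ _
    (fun s => [set w | pmor V (sval s) t0 w = x])).
  - by move=> s.
  - by move=> r s t; exact: le_trans.
  - by move=> r s; have [|/ltW] := leP (sval r) (sval s); auto.
  - by move=> s w; rewrite pmor1.
  - by move=> r s t w; exact: pmorM.
  - move=> [s Ls] /=; have /memv_imgP[w _ xw] := xL s Ls.
    rewrite (_ : [set _ | _] =
      [set z | setT z /\ pmor V s t0 z = pmor V s t0 w]).
      apply: affine_fiber => //; exists w, fullv.
      by apply/seteqP; split=> // z _; rewrite /= memvf.
    by rewrite -xw; apply/seteqP; split=> z //= [].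
  - move=> [r Lr] [s Ls] w /= rs <-; apply: pmorM => //.
    by case/andP: Ls.
have [psi [psiphi psiP]] :
    exists psi : forall u : {u | U u}, 'Hom(V (sval u), K^o),
    (forall u w, psi u (pmor V t0 (sval u) w) = phi w) /\
    (forall w u, sval u <= sval w ->
      (psi w \o pmor V (sval u) (sval w))%VF = psi u).
  (* Functionals restrict from larger to smaller indices, so the index order is reversed. Extensions
     of [phi] to [V u] exist because the map from [V t0] is injective for [u] in [U]. *)
  pose W (u : {u | U u}) : vectType K := 'Hom(V (sval u), K^o).
  pose q (w u : {u | U u}) (h : W w) : W u :=
    (h \o pmor V (sval u) (sval w))%VF.
  have qlin w u : linear (q w u).
    by move=> a h h'; rewrite /q comp_lfunDl comp_lfunZl.
  have qE w u h : lfun_of (qlin w u) h = q w u h by rewrite lfun_ofE.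
  have [|||||||psi [psiA psiP]] := @inverse_limit_inhabited K _
    (fun w u => sval u <= sval w) _ _ _ W
    (fun w u => lfun_of (qlin w u)) _ _
    (fun u => [set h | (h \o pmor V t0 (sval u) = phi)%VF]).
  - by move=> s.
  - by move=> r s t rs st; exact: le_trans st rs.
  - by move=> r s; have [|/ltW] := leP (sval r) (sval s); auto.
  - by move=> u h; rewrite qE; apply/lfunP => z; rewrite lfunE /= pmor1.
  - move=> r s t h sr ts; rewrite !qE; apply/lfunP => z.
    by rewrite !lfunE /= lfunE /= pmorM.
  - move=> [u Uu] /=; have /andP[t0u /lker0_compVf ku0] := Uu.
    pose h0 : W (exist _ u Uu) := (phi \o (pmor V t0 u)^-1)%VF.
    pose c (h : W (exist _ u Uu)) : 'Hom(V t0, K^o) := (h \o pmor V t0 u)%VF.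
    have clin : linear c.
      by move=> a h h'; rewrite /c comp_lfunDl comp_lfunZl.
    have h0E : c h0 = phi by rewrite /c /h0 -comp_lfunA ku0 comp_lfun1r.
    rewrite (_ : [set _ | _] =
      [set h | setT h /\ lfun_of clin h = lfun_of clin h0]).
      apply: affine_fiber => //; exists h0, fullv.
      by apply/seteqP; split=> // z _; rewrite /= memvf.
    rewrite [lfun_of clin h0]lfun_ofE /= h0E.
    by apply/seteqP; split=> h /=; rewrite [lfun_of clin h]lfun_ofE => // -[].
  - move=> [w Uw] [u Uu] h /= uw; rewrite qE => <-; apply/lfunP => z.
    by rewrite !lfunE /= lfunE /= pmorM//; case/andP: Uu.
  exists psi; split=> [u z|w u uw]; last by rewrite -(psiP _ _ uw) qE.
  by rewrite -(psiA u) lfunE.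
have Iitv : is_interval [set s | L s \/ U s].
  move=> r s + + t /andP[rt ts].
  move=> [Lr|Ur] [Ls|Us].
  - left; apply: LS Lr rt _; apply: le_trans ts _; by case/andP: Ls.
  - have [tt0|/ltW t0t] := leP t t0; [left|right].
      exact: LS Lr rt tt0.
    exact: US Us t0t ts.
  - have tE : t = t0.
      apply/le_anti/andP; split.
        by apply: le_trans ts _; case/andP: Ls.
      by apply: le_trans rt; case/andP: Ur.
    by left; rewrite tE.
  - right; apply: US Us _ ts; apply: le_trans rt; by case/andP: Ur.
pose I := Ivl (ex_intro _ t0 (or_introl Lt0)) Iitv.
pose xx t : V t := match pselect (L t) with
  | left h => y (exist _ t h) | right _ => if U t then pmor V t0 t x else 0 end.
pose ff t : 'Hom(V t, K^o) := match pselect (U t) with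
  | left h => psi (exist _ t h)
  | right _ => if L t then (phi \o pmor V t t0)%VF else 0 end.
have xxL t (h : L t) : xx t = y (exist _ t h).
  by rewrite /xx; case: pselect => // h'; rewrite (bool_irrelevance h' h).
have ffU t (h : U t) : ff t = psi (exist _ t h).
  by rewrite /ff; case: pselect => // h'; rewrite (bool_irrelevance h' h).
(* At an index beyond [t0] and outside [U] the kernel is nonzero, so it contains [G] and hence [x]:
   the default 0 is the image of [x]. *)
have xxr t : t0 <= t -> xx t = pmor V t0 t x.
  move=> t0t; rewrite /xx; case: pselect => [Lt|nLt].
    have tt0 : t <= t0 by case/andP: Lt.
    by rewrite -(yx (exist _ t Lt)) pmorM//= pmor1.
  case: ifPn => //; rewrite /U t0t/= => /(Gker _ t0t)/subvP/(_ _ xG).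
  by rewrite memv_ker => /eqP.
(* Dually, [phi] vanishes on the images from indices outside [L], so the default 0 is again the
   right value. *)
have ffl t w : t <= t0 -> ff t w = phi (pmor V t t0 w).
  move=> tt0; rewrite /ff; case: pselect => [Ut|nUt].
    have t0t : t0 <= t by case/andP: Ut.
    by rewrite -(psiphi (exist _ t Ut)) pmorM//= pmor1.
  case: ifPn => [_|nLt]; first by rewrite lfunE.
  by rewrite phiL// lfunE.
have LE t : L t -> t <= t0 by case/andP.
have UE t : U t -> t0 <= t by case/andP.
have xx_out t : ~ iset I t -> xx t = 0.
  move=> /not_orP[nLt /negP/negbTE nUt]; rewrite /xx nUt.
  by case: pselect.
have ff_out t : ~ iset I t -> ff t = 0.
  move=> /not_orP[/negP/negbTE nLt nUt]; rewrite /ff nLt.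
  by case: pselect.
have xxP s t : s <= t -> iset I s -> pmor V s t (xx s) = xx t.
  move=> st [Ls|Us]; last first.
    have t0s := UE _ Us; have t0t := le_trans t0s st.
    by rewrite !xxr// pmorM.
  have [tt0|/ltW t0t] := leP t t0.
    have Lt := LS _ _ Ls st tt0; rewrite (xxL _ Ls) (xxL _ Lt).
    exact: (yP (exist _ s Ls) (exist _ t Lt)).
  by rewrite (xxr t)// xxL -(yx (exist _ s Ls)) pmorM// LE.
have ffP s t w : s <= t -> iset I t -> ff t (pmor V s t w) = ff s w.
  move=> st [Lt|Ut].
    have tt0 := LE _ Lt; have st0 := le_trans st tt0.
    by rewrite !ffl// pmorM.
  have [st0|/ltW t0s] := leP s t0.
    rewrite (ffl s)// (ffU _ Ut) -(pmorM _ st0 (UE _ Ut)).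
    by rewrite (psiphi (exist _ t Ut)).
  have Us := US _ _ Ut t0s st; rewrite (ffU _ Ut) (ffU _ Us).
  by rewrite -(psiP (exist _ t Ut) (exist _ s Us) st) lfunE.
have ffxx t : iset I t -> ff t (xx t) = 1.
  move=> [Lt|Ut]; first by rewrite ffl ?LE// xxL (yx (exist _ t Lt)).
  by rewrite (ffU _ Ut) xxr ?UE// (psiphi (exist _ t Ut)).
exact: inhabits (Bar xx_out ff_out xxP ffP ffxx).
Qed.
End SplitOff.
End PersistenceModules.

(** * Biorthogonal families of bars *)

Section Biorthogonal.
Variables (K : fieldType) (V : vectType K) (T : choiceType) (D : set T).
Variables (x : T -> V) (phi : T -> 'Hom(V, K^o)).
Hypothesis phix : forall b c, D b -> D c -> phi b (x c) = (b == c)%:R.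

(** The functional [phi b] is 1 at [x b] and kills the other vectors, so [x b] is outside their
    span. *)
Lemma biorthogonal_free (r : seq T) :
  uniq r -> (forall b, b \in r -> D b) -> free (map x r).
Proof.
elim: r => [|b r IHr] /=; first by rewrite nil_free.
move=> /andP[br ur] rD; rewrite free_cons IHr//; last first.
  by move=> c cr; apply: rD; rewrite inE cr orbT.
rewrite andbT; apply/negP => xb.
have /subvP/(_ _ xb) : (<<map x r>> <= lker (phi b))%VS.
  apply/span_subvP => _ /mapP[c cr ->].
  have Dc : D c by apply: rD; rewrite inE cr orbT.
  rewrite memv_ker phix//.
    by rewrite [b == c]eq_sym (negbTE (memPn br _ cr)).
  by apply: rD; exact: mem_head.
rewrite memv_ker phix ?eqxx ?oner_eq0//; apply: rD; exact: mem_head.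
Qed.

(** An infinite [D] would yield more independent vectors than the dimension allows. This is how
    pointwise finiteness bounds the number of summands alive at an index. *)
Lemma biorthogonal_seq : exists r : seq T, uniq r /\ forall b, b \in r <-> D b.
Proof.
have /finite_fsetP[X DX] : finite_set D.
  apply: contrapT => /(infinite_set_fset (\dim {:V}).+1)[X XD].
  have := @biorthogonal_free X (fset_uniq X) (fun b bX => XD b bX).
  rewrite /free size_map => /eqP <-.
  by rewrite ltnNge dimvS ?subvf.
by exists X; split; [exact: fset_uniq|move=> b; rewrite DX].
Qed.

(** Both sides have the same value under each [phi b], and these functionals are jointly
    injective. *)
Lemma biorthogonal_expand (r : seq T) (m : V) :
    uniq r -> (forall b, b \in r <-> D b) ->
    (forall m, (forall b, D b -> phi b m = 0) -> m = 0) ->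
  m = \sum_(b <- r) (phi b m : K) *: x b.
Proof.
move=> ur rD faithful; apply/subr0_eq/faithful => b Db.
rewrite linearB linear_sum /= (bigD1_seq b)//=; last exact/rD.
rewrite big_seq_cond big1 => [|c /andP[/rD Dc cb]].
  by rewrite addr0 linearZ/= phix// eqxx [_ *: _]mulr1 subrr.
by rewrite linearZ/= phix// eq_sym (negbTE cb) scaler0.
Qed.

End Biorthogonal.

(** * Submodules and complete families of bars *)

Section Decomposition.
Variables (R : realType) (K : fieldType).

Section Submodule.
Variables (V : pmod R K) (W : forall t, {vspace V t}).
Hypothesis WP : forall s t v, s <= t -> v \in W s -> pmor V s t v \in W t.

Definition sub_pmor s t : 'Hom(subvs_of (W s), subvs_of (W t)) :=
  (linfun (vsproj (W t)) \o pmor V s t \o linfun vsval)%VF.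

Lemma sub_pmorE s t v : sub_pmor s t v = vsproj (W t) (pmor V s t (vsval v)).
Proof. by rewrite !comp_lfunE !lfunE. Qed.

Lemma sub_pmor1 s v : sub_pmor s s v = v.
Proof. by rewrite sub_pmorE pmor1 vsvalK. Qed.

Lemma sub_pmorM s t u v : s <= t -> t <= u ->
  sub_pmor t u (sub_pmor s t v) = sub_pmor s u v.
Proof.
by move=> st tu; rewrite !sub_pmorE vsprojK ?pmorM// WP// subvsP.
Qed.

Definition subpmod : pmod R K := Pmod sub_pmor1 sub_pmorM.

End Submodule.

(** Only the off-diagonal condition is stated; on the diagonal [bar_norm] applies inside the
    interval. *)
Definition orthogonal_bars (V : pmod R K) (F : set (bar V)) :=
  forall b c, F b -> F c -> b <> c -> forall t, bar_fun b t (bar_vec c t) = 0.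

Section Maximal.
Variables (V : pmod R K) (F : set (bar V)).
Hypothesis orthF : orthogonal_bars F.

Let T := {classic bar V}.

Lemma orthogonal_bars_seq t : exists r : seq T,
  uniq r /\ forall b, b \in r <-> F b /\ iset (bar_ivl b) t.
Proof.
apply: (@biorthogonal_seq _ _ T _ (fun b : T => bar_vec b t)
  (fun b : T => bar_fun b t)) => b c [Fb bt] [Fc ct].
have [->|/eqP bc] := eqVneq b c; first exact: bar_norm.
exact: orthF.
Qed.

(** The sums [q s] over the bars alive at [s] are natural projections. Their kernels form a
    submodule [W], the common kernel of the functionals, which contains [m]. A bar of [W], its
    functional extended along the identity minus [q s], is the new one. *)
Lemma bar_split_off t (m : V t) : m != 0 ->
  (forall b, F b -> bar_fun b t m = 0) ->
  exists b, ~ F b /\ orthogonal_bars (F `|` [set b]).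
Proof.
move=> m0 Fm; have [r rP] := dependent_choice orthogonal_bars_seq.
pose q s (v : V s) := \sum_(b <- r s) (bar_fun b s v : K) *: bar_vec b s.
have qlin s : linear (@q s).
  move=> a u v; rewrite /q scaler_sumr -big_split/=; apply: eq_bigr => b _.
  by rewrite linearP scalerDl scalerA.
(* A bar alive at only one of the two indices contributes to neither side: its vector vanishes at
   [u], or its functional vanishes at [s]. *)
have qnat s u v : s <= u -> pmor V s u (q s v) = q u (pmor V s u v).
  move=> su; rewrite /q linear_sum/=.
  pose f (b : T) := (bar_fun b s v : K) *: bar_vec b u.
  transitivity (\sum_(b <- r s | b \in r u) f b).
    rewrite [RHS]big_mkcond/= !big_seq; apply: eq_bigr => b brs.
    have [Fb bs] := ((rP s).2 b).1 brs.
    rewrite linearZ/= bar_vecP//; case: ifPn => // /negP bru.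
    rewrite bar_vec_out ?scaler0// => bu.
    by apply: bru; apply/(rP u).2.
  transitivity (\sum_(b <- r u | b \in r s) f b).
    rewrite -big_filter -[RHS]big_filter; apply: perm_big; apply: uniq_perm.
    - exact/filter_uniq/(rP s).1.
    - exact/filter_uniq/(rP u).1.
    - by move=> b; rewrite !mem_filter andbC.
  rewrite big_mkcond/= !big_seq; apply: eq_bigr => b bru.
  have [Fb bu] := ((rP u).2 b).1 bru.
  rewrite bar_funP//; case: ifPn => // /negP brs.
  rewrite bar_fun_out ?lfunE ?scale0r// => bs.
  by apply: brs; apply/(rP s).2.
have bar_q b s v : F b -> bar_fun b s (q s v) = bar_fun b s v.
  move=> Fb; have [bs|nbs] := pselect (iset (bar_ivl b) s); last first.
    by rewrite bar_fun_out// !lfunE.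
  rewrite /q linear_sum (bigD1_seq (b : T))/=; last 2 first.
  - by apply/(rP s).2.
  - exact: (rP s).1.
  rewrite linearZ/= bar_norm// [_ *: _]mulr1 big_seq_cond big1 ?addr0//.
  move=> c /andP[/((rP s).2 c).1[Fc _] cb].
  by rewrite linearZ/= orthF ?scaler0// => bc; rewrite bc eqxx in cb.
pose W s := lker (lfun_of (qlin s)).
have WE s v : v \in W s <-> q s v = 0.
  by rewrite memv_ker lfun_ofE; split=> [/eqP|/eqP].
have WP s u v : s <= u -> v \in W s -> pmor V s u v \in W u.
  by move=> su /WE qv; apply/WE; rewrite -qnat// qv linear0.
have FW b s v : F b -> v \in W s -> bar_fun b s v = 0.
  by move=> Fb /WE qv; rewrite -bar_q// qv linear0.
have W_bars s v : (forall b, F b -> bar_fun b s v = 0) -> v \in W s.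
  move=> Fv; apply/WE; rewrite /q big_seq big1// => b /((rP s).2 b).1[Fb _].
  by rewrite Fv// scale0r.
have Wq s v : v - q s v \in W s.
  by apply: W_bars => b Fb; rewrite linearB/= bar_q// subrr.
have [w] : inhabited (bar (subpmod WP)).
  apply: (@exists_bar_at _ _ (subpmod WP) t (vsproj (W t) m)).
  apply: contra m0 => /eqP/(congr1 vsval).
  by rewrite vsprojK ?linear0; [move->|exact: W_bars].
pose x s : V s := vsval (bar_vec w s).
have xW s : x s \in W s by exact: subvsP.
have plin s : linear (fun v => bar_fun w s (vsproj (W s) (v - q s v))).
  by move=> a u v; rewrite qlin opprD addrACA -scalerBr !linearP.
pose p s := lfun_of (plin s).
have pE s v : p s v = bar_fun w s (vsproj (W s) (v - q s v)).
  by rewrite lfun_ofE.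
have x_out s : ~ iset (bar_ivl w) s -> x s = 0.
  by move=> ws; rewrite /x bar_vec_out// linear0.
have p_out s : ~ iset (bar_ivl w) s -> p s = 0.
  by move=> ws; apply/lfunP => v; rewrite pE bar_fun_out// !lfunE.
have xP s u : s <= u -> iset (bar_ivl w) s -> pmor V s u (x s) = x u.
  move=> su ws; rewrite /x -(bar_vecP su ws)/= sub_pmorE vsprojK//.
  exact: (WP _ _ _ su (xW s)).
have pP s u v : s <= u -> iset (bar_ivl w) u ->
    p u (pmor V s u v) = p s v.
  move=> su wu; rewrite !pE -(bar_funP _ su wu) /= sub_pmorE.
  by rewrite (vsprojK (Wq s v)) -qnat// -linearB.
have px s : iset (bar_ivl w) s -> p s (x s) = 1.
  move=> ws; rewrite pE ((WE s (x s)).1 (xW s)) subr0.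
  by rewrite vsvalK bar_norm.
pose b := Bar x_out p_out xP pP px.
exists b; split=> [Fb|c d].
  have [s bs] := ivl_neq0 (bar_ivl b).
  have /eqP := bar_norm bs; rewrite (FW _ _ _ Fb (xW s)).
  by rewrite eq_sym oner_eq0.
move=> [Fc|->] [Fd|->] cd s //=.
- exact: orthF.
- exact: FW Fc (xW s).
(* [q] fixes the vectors of the old bars, so the new functional kills them. *)
- rewrite pE (_ : bar_vec d s - _ = 0) ?linear0//; apply/eqP.
  rewrite subr_eq0; apply/eqP; rewrite /q.
  have [ds|nds] := pselect (iset (bar_ivl d) s); last first.
    rewrite bar_vec_out// big_seq big1// => e _.
    by rewrite linear0 scale0r.
  rewrite (bigD1_seq (d : T))/=; last 2 first.
  - by apply/(rP s).2.
  - exact: (rP s).1.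
  rewrite bar_norm// scale1r big_seq_cond big1 ?addr0//.
  move=> e /andP[/((rP s).2 e).1[Fe _] /eqP ed].
  by rewrite orthF// scale0r.
Qed.

End Maximal.

(** Orthogonality is a condition on pairs, so it passes to unions of chains; a maximal family is
    complete, since otherwise [bar_split_off] enlarges it. *)
Lemma exists_complete_bars (V : pmod R K) : exists F : set (bar V),
  orthogonal_bars F /\
  forall t m, (forall b, F b -> bar_fun b t m = 0) -> m = 0.
Proof.
have [|F [orthF Fmax]] :=
  @Zorn_bigcup _ [set F : set (bar V) | orthogonal_bars F].
  move=> F orthF Ftot b c [A FA Ab] [B FB Bc].
  have [AB|BA] := Ftot _ _ FA FB.
  - by apply: (orthF _ FB) => //; exact: AB.
  - by apply: (orthF _ FA) => //; exact: BA.
exists F; split=> // t m Fm; apply/eqP/negP => m0.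
have [b [Fb orthFb]] := bar_split_off orthF (introN idP m0) Fm.
apply: Fmax orthFb; split=> [c|/(_ b) Fb']; first by left.
by apply/Fb/Fb'; right.
Qed.

End Decomposition.

(** * Interval modules in coordinates *)

Section RowCoordinate.
Variable K : fieldType.

(* The inverse of [const_mx] on row vectors of length 1; it is zero on row
   vectors of length 0. *)
Definition rv_coord (b : bool) (v : 'rV[K]_b) : K^o := \sum_j v 0 j.

Lemma rv_coord_linear b : linear (@rv_coord b).
Proof.
move=> a u v; rewrite /rv_coord scaler_sumr -big_split/=.
by apply: eq_bigr => j _; rewrite !mxE.
Qed.

Lemma rv_coord_const (b : bool) (a : K) :
  b -> rv_coord (const_mx a : 'rV_b) = a.
Proof. by case: b => // _; rewrite /rv_coord big_ord1 mxE. Qed.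

Lemma rv_coordK (b : bool) (v : 'rV[K]_b) : const_mx (rv_coord v) = v.
Proof.
case: b v => v; last by rewrite [LHS]thinmx0 thinmx0.
by apply/rowP => j; rewrite mxE /rv_coord big_ord1 [j]ord1.
Qed.

Lemma rv_out (b : bool) (v w : 'rV[K]_b) : ~~ b -> v = w.
Proof. by case: b v w => // v w _; rewrite [LHS]thinmx0 [RHS]thinmx0. Qed.

Lemma rv_coord0 (b : bool) : rv_coord (const_mx 0 : 'rV_b) = 0.
Proof. by rewrite /rv_coord big1// => j _; rewrite mxE. Qed.

(** If one of the lengths is 0, both sides vanish; otherwise the matrix is the identity. *)
Lemma rv_pid_mx1E (a b : bool) (v : 'rV[K]_a) :
  v *m (pid_mx 1 : 'M_(a, b)) = const_mx (rv_coord v).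
Proof.
case: b; last by rewrite [LHS]thinmx0 [RHS]thinmx0.
case: a v => v; first by rewrite pid_mx_1 mulmx1 rv_coordK.
by rewrite thinmx0 mul0mx; apply/rowP => j; rewrite !mxE /rv_coord big_ord0.
Qed.

Lemma const_mx0 (b : bool) : const_mx 0 = 0 :> 'rV[K]_b.
Proof. by apply/rowP => j; rewrite !mxE. Qed.

Lemma const_mx_linear (b : bool) : linear (@const_mx K^o 1 b).
Proof. by move=> a u v; apply/rowP => j; rewrite !mxE. Qed.

End RowCoordinate.

(** * Morphisms out of and into interval modules *)

Section PersistenceModuleFunctors.
Variables (R : realType) (K : fieldType).

Lemma ivlmod_morE (I : ivl R) (s t : R) (st : s <= t) v :
  ivlmod_mor K I st v = const_mx (rv_coord v).
Proof. by rewrite lfunE /= rv_pid_mx1E. Qed.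

Section PmodOf.
Variable M : pfdmod R K.

(** Extended by zero to pairs with [t < s], to fit the total transition maps of [pmod]. *)
Definition fun_pmor (s t : R) : 'Hom(M s, M t) :=
  match pselect (s <= t) with
  | left st => @fmor (poset_cat R) (vect K) M s t st | right _ => 0 end.

Lemma fun_pmorE s t (st : s <= t) :
  fun_pmor s t = @fmor (poset_cat R) (vect K) M s t st.
Proof.
rewrite /fun_pmor; case: pselect => // st'.
by rewrite (bool_irrelevance st' st).
Qed.

Lemma fun_pmor1 s v : fun_pmor s s v = v.
Proof.
rewrite (fun_pmorE (lexx s)); have fmor1s := @fmor1 (poset_cat R) (vect K) M s.
exact: etrans (congr1 (fun g : 'Hom(M s, M s) => g v) fmor1s) (id_lfunE v).
Qed.

Lemma fun_pmorM s t u v : s <= t -> t <= u ->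
  fun_pmor t u (fun_pmor s t v) = fun_pmor s u v.
Proof.
move=> st tu; rewrite (fun_pmorE st) (fun_pmorE tu).
rewrite (fun_pmorE (le_trans st tu)) -comp_lfunE; congr (fun_of_lfun _ v).
exact: esym (@fmorM (poset_cat R) (vect K) M s t u tu st).
Qed.

Definition pmod_of : pmod R K := Pmod fun_pmor1 fun_pmorM.

Lemma pmod_ofE s t (st : s <= t) :
  pmor pmod_of s t = @fmor (poset_cat R) (vect K) M s t st.
Proof. exact: fun_pmorE. Qed.

(** The vector [x t] is the image of 1 at [t]. Naturality holds at indices outside [I] because there
    the coordinate or [x] vanishes. *)
Lemma ivlmod_inclusion (I : ivl R) (x : forall t, pmod_of t) :
  (forall t, ~ iset I t -> x t = 0) ->
  (forall s t, s <= t -> iset I s -> pmor pmod_of s t (x s) = x t) ->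
  exists a : @mor (pfdmod R K) (ivlmod K I) M,
    forall t v, ncomp a t v = rv_coord v *: x t.
Proof.
move=> x_out xP.
have alin t : linear (fun v : ivlmod_obj K I t => rv_coord v *: x t).
  by move=> a u v; rewrite rv_coord_linear scalerDl scalerA.
have aP s t (st : s <= t) v : rv_coord (ivlmod_mor K I st v) *: x t =
    pmor pmod_of s t (rv_coord v *: x s).
  rewrite ivlmod_morE linearZ/=.
  have [Is|nIs] := pselect (iset I s); last first.
    rewrite (rv_out v (const_mx 0)); last exact/asboolPn.
    by rewrite !rv_coord0 !scale0r.
  rewrite xP//; have [It|nIt] := pselect (iset I t); last first.
    by rewrite x_out// !scaler0.
  by rewrite rv_coord_const//; exact/asboolP.
have anat s t (st : @mor (poset_cat R) s t) :
    cmor (lfun_of (alin t) : @mor (vect K) _ _) (fmor (ivlmod K I) st) =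
    cmor (fmor M st) (lfun_of (alin s) : @mor (vect K) _ _).
  apply/lfunP => v; rewrite !comp_lfunE (lfun_ofE (alin t)) (lfun_ofE (alin s)).
  by have := aP s t st v; rewrite (pmod_ofE st).
exists (Nattrans anat : @mor (pfdmod R K) _ _) => t v.
exact: lfun_ofE.
Qed.

(** Dual to the inclusion: the value of [phi t] becomes the single entry of a row, and outside [I]
    the target is zero. *)
Lemma ivlmod_retraction (I : ivl R) (phi : forall t, 'Hom(pmod_of t, K^o)) :
  (forall t, ~ iset I t -> phi t = 0) ->
  (forall s t v, s <= t -> iset I t -> phi t (pmor pmod_of s t v) = phi s v) ->
  exists a : @mor (pfdmod R K) M (ivlmod K I),
    forall t v, ncomp a t v = const_mx (phi t v).
Proof.
move=> phi_out phiP.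
have alin t : linear (fun v : M t => const_mx (phi t v) : ivlmod_obj K I t).
  by move=> a u v; rewrite linearP const_mx_linear.
have aP s t (st : s <= t) v : const_mx (phi t (pmor pmod_of s t v)) =
    ivlmod_mor K I st (const_mx (phi s v)).
  rewrite ivlmod_morE.
  have [It|nIt] := pselect (iset I t); last first.
    by apply: rv_out; exact/asboolPn.
  rewrite phiP//; have [Is|nIs] := pselect (iset I s).
    by rewrite rv_coord_const//; exact/asboolP.
  by rewrite phi_out// lfunE rv_coord0.
have anat s t (st : @mor (poset_cat R) s t) :
    cmor (lfun_of (alin t) : @mor (vect K) _ _) (fmor M st) =
    cmor (fmor (ivlmod K I) st) (lfun_of (alin s) : @mor (vect K) _ _).
  apply/lfunP => v; rewrite !comp_lfunE (lfun_ofE (alin t)) (lfun_ofE (alin s)).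
  by have := aP s t st v; rewrite (pmod_ofE st).
exists (@Nattrans (poset_cat R) (vect K) M (ivlmod K I)
  (fun t => lfun_of (alin t)) anat) => t v.
exact: lfun_ofE.
Qed.

End PmodOf.

(** A direct sum decomposition in coordinates: inclusions and retractions of the summands, pairwise
    orthogonal, with jointly injective retractions. Ranks are computed from this form. *)
Definition bars_decompose (M : pfdmod R K) (B : barcode R)
    (beta : B -> bar (pmod_of M)) :=
  [/\ forall b, bar_ivl (beta b) = bc_ivl b,
    forall b c, b <> c -> forall t, bar_fun (beta b) t (bar_vec (beta c) t) = 0
    & forall t m, (forall b, bar_fun (beta b) t m = 0) -> m = 0].

End PersistenceModuleFunctors.

(** * Monomorphisms and epimorphisms *)

Section PointwiseMorphisms.
Variables (R : realType) (K : fieldType).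
Implicit Types M N : pfdmod R K.

Lemma ncomp_pmor M N (f : @mor (pfdmod R K) M N) (s t : R) v : s <= t ->
  ncomp f t (pmor (pmod_of M) s t v) = pmor (pmod_of N) s t (ncomp f s v).
Proof.
move=> st; rewrite !(pmod_ofE _ st).
have /(congr1 (fun g : 'Hom(M s, N t) => g v)) := @natural _ _ _ _ f s t st.
by rewrite /= !comp_lfunE.
Qed.

Lemma ncomp_comp M N P (g : @mor (pfdmod R K) N P) (f : @mor (pfdmod R K) M N)
  (t : R) v : ncomp (cmor g f) t v = ncomp g t (ncomp f t v).
Proof. exact: comp_lfunE. Qed.

Lemma pfdmod_morP M N (f g : @mor (pfdmod R K) M N) :
  (forall (t : R) v, ncomp f t v = ncomp g t v) -> f = g.
Proof. by move=> fg; apply: nattransP => t; apply/lfunP => v; exact: fg. Qed.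

Definition ivl_ge (t : R) : ivl R.
Proof.
refine (@Ivl R [set s | t <= s] (ex_intro _ t (lexx t)) _).
by move=> r s tr _ u /andP[ru _]; exact: le_trans tr ru.
Defined.

Definition ivl_le (t : R) : ivl R.
Proof.
refine (@Ivl R [set s | s <= t] (ex_intro _ t (lexx t)) _).
by move=> r s _ st u /andP[_ us]; exact: le_trans us st.
Defined.

(** The images of [x] define a morphism to [M] from the interval module on the half-line above [t].
    Its composite with [f] is zero, so the morphism is zero, and its value at [t] is [x]. *)
Lemma mono_injective M N (f : @mor (pfdmod R K) M N) (t : R) (x : M t) :
  is_mono f -> ncomp f t x = 0 -> x = 0.
Proof.
move=> f_mono fx.
pose y s : pmod_of M s := if t <= s then pmor (pmod_of M) t s x else 0.
have yE s : t <= s -> y s = pmor (pmod_of M) t s x by rewrite /y => ->.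
have y_out s : ~~ (t <= s) -> y s = 0 by move=> ts; rewrite /y ifN.
have [||a aE] := @ivlmod_inclusion R K M (ivl_ge t) y.
- by move=> s /negP; exact: y_out.
- by move=> r s rs tr; rewrite !yE ?(le_trans tr)// pmorM.
have [||b bE] := @ivlmod_inclusion R K M (ivl_ge t) (fun=> 0) => //.
  by move=> r s _ _; rewrite linear0.
have fy s : ncomp f s (y s) = 0.
  have [ts|ts] := boolP (t <= s); last by rewrite y_out// linear0.
  by rewrite yE// ncomp_pmor// fx linear0.
have ab : a = b.
  apply: f_mono; apply: pfdmod_morP => s v; rewrite !ncomp_comp.
  rewrite (aE s v) (bE s v) scaler0 linearZ linear0 /=.
  by rewrite fy scaler0.
have := bE t (const_mx 1).
rewrite -ab aE rv_coord_const; last exact/asboolP/lexx.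
by rewrite scale1r scaler0 yE// pmor1.
Qed.

(** A functional vanishing on the image but not at [y] defines a nonzero morphism from [N] to the
    interval module on the half-line below [t]. It becomes zero after composition with [f], a
    contradiction. *)
Lemma epi_surjective M N (f : @mor (pfdmod R K) M N) (t : R) :
  is_epi f -> limg (ncomp f t) = fullv.
Proof.
move=> f_epi; apply/eqP; rewrite eqEsubv subvf; apply/subvP => y _.
apply: contrapT => /negP/exists_functional[phi phiy phif].
pose psi s : 'Hom(pmod_of N s, K^o) :=
  if s <= t then (phi \o pmor (pmod_of N) s t)%VF else 0.
have psiE s v : s <= t -> psi s v = phi (pmor (pmod_of N) s t v).
  by rewrite /psi => ->; rewrite lfunE.
have psi_out s : ~~ (s <= t) -> psi s = 0 by move=> st; rewrite /psi ifN.
have [||a aE] := @ivlmod_retraction R K N (ivl_le t) psi.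
- by move=> s /negP; exact: psi_out.
- by move=> r s v rs st; rewrite !psiE ?(le_trans rs)// pmorM.
have [||b bE] := @ivlmod_retraction R K N (ivl_le t) (fun=> 0) => //.
  by move=> r s v _ _; rewrite !lfunE.
have psif s v : psi s (ncomp f s v) = 0.
  have [st|st] := boolP (s <= t); last by rewrite psi_out// lfunE.
  by rewrite psiE// -ncomp_pmor// phif// memv_img ?memvf.
have ab : a = b.
  apply: f_epi; apply: pfdmod_morP => s v; rewrite !ncomp_comp.
  by rewrite (aE s _) (bE s _) psif lfunE.
have := congr1 (@rv_coord _ _) (bE t y); rewrite -ab aE !rv_coord_const.
- rewrite psiE// pmor1 phiy lfunE => /eqP; by rewrite oner_eq0.
- exact/asboolP/lexx.
- exact/asboolP/lexx.
Qed.

End PointwiseMorphisms.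

(** * Decompositions and complete families of bars *)

Section Decomposes.
Variables (R : realType) (K : fieldType) (M : pfdmod R K).
Variable B : set (ivl R * nat).

Let T := Barcode B.

Let V (t : R) (b : T) : lmodType K := ivlmod_obj K (bc_ivl b) t.

Let D := dsum_functor
  (fun b : T => functor_comp (vect_incl K) (ivlmod K (bc_ivl b))).

Let D_fmorE s t (st : @mor (poset_cat R) s t) (y : dsum (V s)) b :
  dsum_val (fmor D st y : dsum (V t)) b = const_mx (rv_coord (y b)).
Proof. exact: ivlmod_morE. Qed.

(** The functionals are the coordinates of the isomorphism. The inverse sums over the finitely many
    bars alive at [t]; this finiteness also puts the coordinates in the direct sum. *)
Lemma decomposes_of_bars (beta : T -> bar (pmod_of M)) :
  bars_decompose beta -> decomposes M B.
Proof.
move=> [betaI orth faithful].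
have rex t : exists r : seq {classic T},
    uniq r /\ forall b, b \in r <-> iset (bc_ivl (b : T)) t.
  apply: (@biorthogonal_seq _ _ {classic T} _
    (fun b : T => bar_vec (beta b) t) (fun b : T => bar_fun (beta b) t)).
  move=> b c; rewrite -!betaI => Ib Ic.
  have [->|/eqP bc] := eqVneq b c; first exact: bar_norm.
  exact: orth.
have [r rP] := dependent_choice rex.
have ffin t (m : pmod_of M t) :
    finite_set [set b : T | (const_mx (bar_fun (beta b) t m) : V t b) != 0].
  apply: (@sub_finite_set _ _ [set` r t]); last exact: finite_seq.
  move=> b /= bm; apply/(rP t).2; apply: contrapT => nIb.
  by move/eqP: bm; apply; apply: rv_out; exact/asboolPn.
pose f0 t (m : pmod_of M t) : dsum (V t) := Dsum (ffin t m).
have flin t : linear (f0 t).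
  move=> a u v; apply: dsumP => b.
  by rewrite /= linearP const_mx_linear.
pose f t : {linear pmod_of M t -> dsum (V t)} :=
  HB.pack (f0 t) (GRing.isLinear.Build K _ _ _ (f0 t) (flin t)).
pose g0 t (y : dsum (V t)) : pmod_of M t :=
  \sum_(b <- r t) rv_coord (y b) *: bar_vec (beta b) t.
have glin t : linear (g0 t).
  move=> a u v; rewrite /g0 scaler_sumr -big_split/=; apply: eq_bigr => b _.
  by rewrite rv_coord_linear scalerDl scalerA.
pose g t : {linear dsum (V t) -> pmod_of M t} :=
  HB.pack (g0 t) (GRing.isLinear.Build K _ _ _ (g0 t) (glin t)).
have fE t m b : dsum_val (f t m) b = const_mx (bar_fun (beta b) t m) by [].
have fK t m : g t (f t m) = m.
  rewrite [RHS](@biorthogonal_expand _ _ {classic T}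
    (fun b : T => iset (bc_ivl b) t)
    (fun b : T => bar_vec (beta b) t) (fun b : T => bar_fun (beta b) t)
    _ (r t)).
  - rewrite /= /g0 !big_seq; apply: eq_bigr => b /(rP t).2 Ib.
    by rewrite rv_coord_const//; exact/asboolP.
  - move=> b c; rewrite -!betaI => Ib Ic.
    have [->|/eqP bc] := eqVneq b c; first exact: bar_norm.
    exact: orth.
  - exact: (rP t).1.
  - exact: (rP t).2.
  - move=> m' m'0; apply: faithful => b.
    have [Ib|nIb] := pselect (iset (bc_ivl b) t); first exact: m'0.
    by rewrite bar_fun_out ?lfunE// betaI.
have gK t y : f t (g t y) = y.
  apply: dsumP => b; rewrite fE.
  have [Ib|nIb] := pselect (iset (bc_ivl b) t); last first.
    by apply: rv_out; exact/asboolPn.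
  rewrite -[RHS]rv_coordK; congr const_mx; rewrite /= /g0 linear_sum.
  rewrite (bigD1_seq (b : {classic T}))/=; last 2 first.
  - exact/(rP t).2.
  - exact: (rP t).1.
  rewrite linearZ/= (bar_norm (b := beta b)) ?betaI// [_ *: _]mulr1.
  rewrite big1 ?addr0// => c /eqP cb.
  by rewrite linearZ/= orth ?scaler0//; exact: nesym.
have fP s t m : s <= t -> forall b,
    dsum_val (f t (pmor (pmod_of M) s t m)) b =
    const_mx (rv_coord (dsum_val (f s m) b)).
  move=> st b; rewrite !fE.
  have [It|nIt] := pselect (iset (bc_ivl b) t); last first.
    by apply: rv_out; exact/asboolPn.
  rewrite bar_funP// ?betaI//; congr const_mx.
  have [Is|nIs] := pselect (iset (bc_ivl b) s).
    by rewrite rv_coord_const//; exact/asboolP.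
  by rewrite bar_fun_out ?betaI// lfunE rv_coord0.
have fnat s t (st : @mor (poset_cat R) s t) :
    @cmor (Vect K) _ _ _ (f t) (fmor (functor_comp (vect_incl K) M) st) =
    @cmor (Vect K) _ _ _ (fmor D st) (f s).
  apply: linear_eqP => m; apply: dsumP => b.
  rewrite [RHS]D_fmorE -(fP _ _ _ st) (pmod_ofE _ st); reflexivity.
have gnat s t (st : @mor (poset_cat R) s t) :
    @cmor (Vect K) _ _ _ (g t) (fmor D st) =
    @cmor (Vect K) _ _ _ (fmor (functor_comp (vect_incl K) M) st) (g s).
  apply: linear_eqP => y.
  have E : f t (fmor (functor_comp (vect_incl K) M) st (g s y)) =
      fmor D st (y : dsum (V s)).
    rewrite -[in RHS](gK s y).
    exact: (congr1 (fun h : {linear M s -> dsum (V t)} => h (g s y))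
      (fnat s t st)).
  exact: etrans (congr1 (g t) (esym E)) (fK t _).
exists (@Nattrans _ _ (functor_comp (vect_incl K) M) D f fnat).
exists (@Nattrans _ _ D (functor_comp (vect_incl K) M) g gnat).
by split; apply: nattransP => t; apply: linear_eqP => x; [exact: fK|exact: gK].
Qed.

(** The unit vectors and coordinate functionals of the direct sum are carried to [M] by the
    isomorphism. *)
Lemma bars_of_decomposes : decomposes M B ->
  exists beta : T -> bar (pmod_of M), bars_decompose beta.
Proof.
move=> [F [G [GF FG]]].
pose f t : {linear pmod_of M t -> dsum (V t)} := F t.
pose g t : {linear dsum (V t) -> pmod_of M t} := G t.
have fK t m : g t (f t m) = m.
  exact: (congr1 (fun h : nattrans (functor_comp (vect_incl K) M)
    (functor_comp (vect_incl K) M) => (h t : {linear M t -> M t}) m) GF).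
have gK t y : f t (g t y) = y.
  exact: (congr1 (fun h : nattrans D D =>
    (h t : {linear dsum (V t) -> dsum (V t)}) y) FG).
have fP s t m b : s <= t -> dsum_val (f t (pmor (pmod_of M) s t m)) b =
    const_mx (rv_coord (dsum_val (f s m) b)).
  move=> st; rewrite (pmod_ofE _ st) -(D_fmorE st).
  by have /(congr1 (fun h : {linear M s -> dsum (V t)} =>
    dsum_val (h m) b)) := @natural _ _ _ _ F s t st.
pose d (c b : T) : K := if pselect (c = b) then 1 else 0.
have dE b : d b b = 1 by rewrite /d; case: pselect.
have dN c b : c <> b -> d c b = 0 by rewrite /d; case: pselect.
have efin t b : finite_set [set c : T | (const_mx (d c b) : V t c) != 0].
  apply: (@sub_finite_set _ _ [set b]); last exact: finite_set1.
  move=> c /=; apply: contra_neqP => cb; rewrite dN//.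
pose e t b : dsum (V t) := Dsum (efin t b).
pose x b t : pmod_of M t := g t (e t b).
have x_out b t : ~ iset (bc_ivl b) t -> x b t = 0.
  move=> nIb; rewrite /x (_ : e t b = 0) ?linear0//; apply: dsumP => c /=.
  have [->|cb] := pselect (c = b); first by apply: rv_out; exact/asboolPn.
  by rewrite dN//; exact: const_mx0.
have philin b t : linear (fun m : pmod_of M t => rv_coord (dsum_val (f t m) b)).
  by move=> a u v; rewrite linearP /= rv_coord_linear.
have phi_out b t : ~ iset (bc_ivl b) t -> lfun_of (philin b t) = 0.
  move=> nIb; apply/lfunP => m; rewrite lfun_ofE lfunE /=.
  rewrite (rv_out (dsum_val (f t m) b) (const_mx 0)) ?rv_coord0//.
  exact/asboolPn.
have xP b s t : s <= t -> iset (bc_ivl b) s ->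
    pmor (pmod_of M) s t (x b s) = x b t.
  move=> st Ibs; rewrite -[LHS]fK; congr (g t _); apply: dsumP => c.
  rewrite fP// gK /=; congr const_mx.
  have [->|cb] := pselect (c = b); last by rewrite dN// rv_coord0.
  by rewrite rv_coord_const//; exact/asboolP.
have phiP b s t m : s <= t -> iset (bc_ivl b) t ->
    lfun_of (philin b t) (pmor (pmod_of M) s t m) = lfun_of (philin b s) m.
  move=> st Ibt; rewrite !lfun_ofE fP// rv_coord_const//; exact/asboolP.
have phix b t : iset (bc_ivl b) t -> lfun_of (philin b t) (x b t) = 1.
  move=> Ibt; rewrite lfun_ofE gK /= dE rv_coord_const//; exact/asboolP.
exists (fun b => Bar (@x_out b) (@phi_out b) (@xP b) (@phiP b) (@phix b)).
split=> [//|b c bc t|t m phim] /=.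
  by rewrite lfun_ofE gK /= dN// rv_coord0.
rewrite -(fK t m) (_ : f t m = 0) ?linear0//; apply: dsumP => b.
have := phim b; rewrite /= lfun_ofE => fm0.
by rewrite -[LHS]rv_coordK fm0; exact: const_mx0.
Qed.

End Decomposes.

(** * The structure theorem and ranks *)

Section StructureTheorem.
Variables (R : realType) (K : fieldType) (M : pfdmod R K).

(** The bars of a complete family with interval [I] are all alive at a point of [I], hence finite in
    number. Numbering them by their position in a list makes the barcode natural. *)
Lemma exists_natural_decomposition : exists B : set (ivl R * nat),
  is_natural B /\ decomposes M B.
Proof.
have [F [orthF faithful]] := exists_complete_bars (pmod_of M).
have lex (I : ivl R) : exists l : seq {classic bar (pmod_of M)},
    uniq l /\ forall b, b \in l <-> F b /\ bar_ivl b = I.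
  have [t It] := ivl_neq0 I.
  have [r [ur rP]] := orthogonal_bars_seq orthF t.
  exists [seq b <- r | `[< bar_ivl b = I >]]; split; first exact: filter_uniq.
  move=> b; rewrite mem_filter; split.
    by move=> /andP[/asboolP bI /rP[Fb _]].
  move=> [Fb bI]; apply/andP; split; first exact/asboolP.
  by apply/rP; rewrite bI.
have [l lP] := dependent_choice lex.
pose B : set (ivl R * nat) := [set p | (p.2 < size (l p.1))%N].
exists B; split=> [I m n mn /=|]; first exact: leq_ltn_trans.
(* The bar is characterised by its [index] in the list, which needs no default bar and shows that
   distinct elements get distinct bars. *)
have bex (b : Barcode B) : exists c : {classic bar (pmod_of M)},
    [/\ F c, bar_ivl c = bc_ivl b & index c (l (bc_ivl b)) = (sval b).2].
  case: b => [[I n] /= nI]; rewrite /bc_ivl/=; have [ul lI] := lP I.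
  rewrite /B/= in nI; case: (l I) => [|c0 s] in nI ul lI *; first by [].
  have [Fc cI] := (lI (nth c0 (c0 :: s) n)).1 (mem_nth c0 nI).
  by exists (nth c0 (c0 :: s) n); split=> //; exact: index_uniq.
have [beta betaP] := dependent_choice bex.
apply: (@decomposes_of_bars _ _ _ _ beta); split.
- by move=> b; have [] := betaP b.
- move=> b c bc t; have [Fb Ib nb] := betaP b; have [Fc Ic nc] := betaP c.
  apply: orthF => // bcE; apply: bc; apply: sval_injective.
  have svalE (x : Barcode B) : sval x = (bc_ivl x, (sval x).2).
    by case: x => -[].
  by rewrite (svalE b) (svalE c) -nb -nc -Ib -Ic bcE.
(* Every bar of [F] is a value of [beta], so completeness of [F] applies. *)
- move=> t m m0; apply: faithful => c Fc.
  have cl : (c : {classic _}) \in l (bar_ivl c) by apply/(lP (bar_ivl c)).2.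
  have Bc : B (bar_ivl c, index (c : {classic _}) (l (bar_ivl c))).
    by rewrite /B/= index_mem.
  have [Fb Ib nb] := betaP (exist _ _ Bc); rewrite /bc_ivl/= in Ib nb.
  set b := exist _ _ Bc in Fb Ib nb.
  have bl : beta b \in l (bar_ivl c) by apply/(lP (bar_ivl c)).2.
  have bc : beta b = c.
    by rewrite -[LHS](nth_index (c : {classic _}) bl) nb nth_index.
  by have := m0 b; rewrite bc.
Qed.

(** Existence suffices for [xget] to return a set with the two properties instead of its default. *)
Lemma barsP : is_natural (bars M) /\ decomposes M (bars M).
Proof.
have [B BP] := exists_natural_decomposition.
exact: (@xgetPex _ set0 [set B | is_natural B /\ decomposes M B]
  (ex_intro _ B BP)).
Qed.

Lemma barc_bars : exists beta : barc M -> bar (pmod_of M), bars_decompose beta.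
Proof. exact: (bars_of_decomposes barsP.2). Qed.

Lemma barc_seq (t : R) : exists r : seq {classic barc M},
  uniq r /\ forall b, b \in r <-> iset (bc_ivl b) t.
Proof.
have [beta [betaI orth _]] := barc_bars.
apply: (@biorthogonal_seq _ _ {classic barc M} _
  (fun b => bar_vec (beta b) t) (fun b => bar_fun (beta b) t)).
move=> b c; rewrite -!betaI => Ib Ic.
have [->|/eqP bc] := eqVneq b c; first exact: bar_norm.
exact: orth.
Qed.

(** The vectors at [t] of the bars containing both indices are a basis of the image. *)
Lemma barc_rank (s t : R) (r : seq {classic barc M}) : s <= t -> uniq r ->
  (forall b, b \in r <-> iset (bc_ivl b) s /\ iset (bc_ivl b) t) ->
  size r = \dim (limg (pmor (pmod_of M) s t)).
Proof.
move=> st ur rP; have [beta [betaI orth faithful]] := barc_bars.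
pose x t' (b : {classic barc M}) := bar_vec (beta b) t'.
have phix t' (b c : {classic barc M}) :
    iset (bc_ivl b) t' -> iset (bc_ivl c) t' ->
    bar_fun (beta b) t' (x t' c) = (b == c)%:R.
  rewrite -!betaI => Ib Ic.
  by have [->|/eqP bc] := eqVneq b c; [exact: bar_norm|exact: orth].
have xst b : iset (bc_ivl b) s -> pmor (pmod_of M) s t (x s b) = x t b.
  by rewrite -betaI; exact: bar_vecP.
have xfree : free [seq x t b | b <- r].
  apply: (biorthogonal_free (phix t)) => // b; by move=> /rP[].
have [q [uq qP]] := barc_seq s.
have <- : size [seq x t b | b <- r] = size r by rewrite size_map.
rewrite -(eqP xfree); congr (\dim _).
(* The bars alive at [s] span the source, and the transition map kills those not alive at [t]. *)
have -> : fullv = <<[seq x s b | b <- q]>>%VS.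
  apply/eqP; rewrite eqEsubv subvf andbT; apply/subvP => m _.
  rewrite [m](biorthogonal_expand (phix s) _ uq qP); last first.
    move=> m' m'0; apply: faithful => b.
    have [Ib|nIb] := pselect (iset (bc_ivl b) s); first exact: m'0.
    by rewrite bar_fun_out ?lfunE// betaI.
  rewrite big_seq; apply: memv_suml => b bq; apply/memvZ/memv_span.
  exact: (map_f (x s)).
rewrite limg_span; apply/eqP; rewrite eqEsubv; apply/andP; split.
  apply/span_subvP => _ /mapP[b /rP[Is It] ->].
  rewrite -xst//; apply/memv_span/map_f/(map_f (x s)).
  exact/qP.
apply/span_subvP => _ /mapP[_ /mapP[b /qP Is ->] ->].
rewrite xst//.
have [It|nIt] := pselect (iset (bc_ivl b) t); last first.
  by rewrite /x bar_vec_out ?mem0v// betaI.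
by apply/memv_span/(map_f (x t))/rP.
Qed.

End StructureTheorem.

(** * Counting bars by ranks *)

Section Cuts.
Variable R : realType.
Implicit Types (I : ivl R) (J : {classic ivl R}) (l : seq {classic ivl R}).

Lemma ivl_between (I : ivl R) (a b c : R) :
  iset I a -> iset I c -> a <= b -> b <= c -> iset I b.
Proof. by move=> Ia Ic ab bc; apply: (ivl_itv Ia Ic); rewrite ab. Qed.

(** A listed interval that does not contain [I] misses some point [p] of [I]; widening the range
    from [s] to [t] to include [p] excludes it. Containing [I] is thus tested at two indices. *)
Lemma finite_inner_cut I l (t0 : R) : iset I t0 -> exists s t : R,
  [/\ iset I s, iset I t, s <= t0, t0 <= t &
    forall J, J \in l -> iset J s -> iset J t -> iset I `<=` iset J].
Proof.
move=> It0; elim: l => [|J l [s [t [Is It st0 t0t IHl]]]].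
  by exists t0, t0; split.
have [IJ|] := pselect (iset I `<=` iset J).
  exists s, t; split=> // J'; rewrite in_cons => /orP[/eqP ->//|]; exact: IHl.
move=> /existsNP[p /not_implyP[Ip nJp]].
have mins : Num.min s p <= s by rewrite ge_min lexx.
have maxt : t <= Num.max t p by rewrite le_max lexx.
exists (Num.min s p), (Num.max t p); split.
- by rewrite /Num.min; case: ifP.
- by rewrite /Num.max; case: ifP.
- exact: le_trans mins st0.
- exact: le_trans t0t maxt.
move=> J'; rewrite in_cons => /orP[/eqP ->|J'l] Js Jt.
  by exfalso; apply: nJp; apply: ivl_between Js Jt _ _;
    rewrite ?ge_min ?le_max lexx orbT.
have st : s <= t by exact: le_trans st0 t0t.
apply: IHl => //; apply: ivl_between Js Jt _ _ => //.
  exact: le_trans st maxt.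
exact: le_trans mins st.
Qed.

(** A single index [u] above [I] detects the listed intervals that contain [I] and reach beyond it;
    [None] stands for the case that there are none. *)
Lemma finite_upper_cut I l : exists o : option R,
  (forall u, o = Some u -> forall x, iset I x -> x <= u) /\
  forall J, J \in l -> iset I `<=` iset J ->
    coincide_above I J <-> (if o is Some u then ~ iset J u else True).
Proof.
have [t0 It0] := ivl_neq0 I.
pose above (u : R) := forall x, iset I x -> x < u.
suff [o [oI ol]] : exists o : option R,
    (forall u, o = Some u -> above u) /\
    forall J, J \in l -> iset I `<=` iset J -> ~ bounds_above I J ->
      exists2 u, o = Some u & iset J u.
  exists o; split=> [u ou x Ix|J Jl IJ]; first exact/ltW/oI.
  split.
    move=> [IJa _]; case: o oI {ol} => // u oI Ju.
    have [t It ut] := IJa _ Ju.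
    by have := oI _ erefl _ It; rewrite ltNge ut.
  move=> nJu; split; last by move=> s Is; exists s => //; exact: IJ.
  apply: contrapT => /(ol _ Jl IJ)[u ou Ju]; by rewrite ou in nJu.
elim: l => [|J l [o [oI ol]]]; first by exists None.
have [IJ|nIJ] := pselect (iset I `<=` iset J /\ ~ bounds_above I J); last first.
  exists o; split=> // J'; rewrite in_cons => /orP[/eqP ->|] //.
    by move=> IJ nIJa; case: nIJ.
  exact: ol.
have [IJs /existsNP[w /not_implyP[Jw Iw]]] := IJ.
have above_w : above w.
  by move=> x Ix; rewrite ltNge; apply/negP => wx; apply: Iw; exists x.
case: o oI ol => [u|] oI ol; last first.
  exists (Some w); split=> [_ [<-]//|J'].
  rewrite in_cons => /orP[/eqP ->|J'l] IJ' nIJ'; first by exists w.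
  by have [] := ol _ J'l IJ' nIJ'.
have uI := oI _ erefl.
(* The smaller witness still lies strictly above [I], and by convexity in every interval that
   contains [t0] and one of the two witnesses. *)
exists (Some (Num.min u w)); split=> [_ [<-] x Ix|J'].
  by rewrite lt_min uI ?above_w.
have t0min : t0 <= Num.min u w by rewrite le_min !ltW ?uI ?above_w.
rewrite in_cons => /orP[/eqP ->|J'l] IJ' nIJ'; exists (Num.min u w) => //.
  by apply: (ivl_between (IJ' _ It0) Jw); rewrite ?ge_min ?lexx ?orbT.
have [_ [<-] J'u] := ol _ J'l IJ' nIJ'.
by apply: (ivl_between (IJ' _ It0) J'u); rewrite ?ge_min ?lexx ?orbT.
Qed.

(** The mirror image of the upper cut: witnesses lie below [I] and are combined by maximum. *)
Lemma finite_lower_cut I l : exists o : option R,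
  (forall v, o = Some v -> forall x, iset I x -> v <= x) /\
  forall J, J \in l -> iset I `<=` iset J ->
    coincide_below I J <-> (if o is Some v then ~ iset J v else True).
Proof.
have [t0 It0] := ivl_neq0 I.
pose below (v : R) := forall x, iset I x -> v < x.
suff [o [oI ol]] : exists o : option R,
    (forall v, o = Some v -> below v) /\
    forall J, J \in l -> iset I `<=` iset J -> ~ bounds_below I J ->
      exists2 v, o = Some v & iset J v.
  exists o; split=> [v ov x Ix|J Jl IJ]; first exact/ltW/oI.
  split.
    move=> [IJb _]; case: o oI {ol} => // v oI Jv.
    have [t It tv] := IJb _ Jv.
    by have := oI _ erefl _ It; rewrite ltNge tv.
  move=> nJv; split; last by move=> s Is; exists s => //; exact: IJ.
  apply: contrapT => /(ol _ Jl IJ)[v ov Jv]; by rewrite ov in nJv.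
elim: l => [|J l [o [oI ol]]]; first by exists None.
have [IJ|nIJ] := pselect (iset I `<=` iset J /\ ~ bounds_below I J); last first.
  exists o; split=> // J'; rewrite in_cons => /orP[/eqP ->|] //.
    by move=> IJ nIJb; case: nIJ.
  exact: ol.
have [IJs /existsNP[w /not_implyP[Jw Iw]]] := IJ.
have below_w : below w.
  by move=> x Ix; rewrite ltNge; apply/negP => xw; apply: Iw; exists x.
case: o oI ol => [v|] oI ol; last first.
  exists (Some w); split=> [_ [<-]//|J'].
  rewrite in_cons => /orP[/eqP ->|J'l] IJ' nIJ'; first by exists w.
  by have [] := ol _ J'l IJ' nIJ'.
have vI := oI _ erefl.
exists (Some (Num.max v w)); split=> [_ [<-] x Ix|J'].
  by rewrite gt_max vI ?below_w.
have maxt0 : Num.max v w <= t0 by rewrite ge_max !ltW ?vI ?below_w.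
rewrite in_cons => /orP[/eqP ->|J'l] IJ' nIJ'; exists (Num.max v w) => //.
  by apply: (ivl_between Jw (IJ' _ It0)); rewrite ?le_max ?lexx ?orbT.
have [_ [<-] J'v] := ol _ J'l IJ' nIJ'.
by apply: (ivl_between J'v (IJ' _ It0)); rewrite ?le_max ?lexx ?orbT.
Qed.

End Cuts.

Lemma size_subset_diff (T : eqType) (q r e : seq T) :
  uniq q -> uniq r -> uniq e -> {subset e <= q} ->
  (forall b, b \in r = (b \in q) && (b \notin e)) ->
  size r = (size q - size e)%N.
Proof.
move=> uq ur ue eq rE; have /perm_size -> : perm_eq q (r ++ e).
  apply: uniq_perm => //.
    rewrite cat_uniq ur ue andbT; apply/hasPn => b be.
    by rewrite rE be andbF.
  move=> b; rewrite mem_cat rE; case be : (b \in e); last by rewrite andbT orbF.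
  by rewrite orbT eq.
by rewrite size_cat addnK.
Qed.

(** By rank-nullity, the loss of dimension is the kernel part, which is at least as large for [B] as
    for [A]. *)
Lemma limg_codim (K : fieldType) (U V : vectType K) (f : 'Hom(U, V))
    (A B : {vspace U}) : (A <= B)%VS ->
  (\dim (f @: B) - \dim (f @: A) <= \dim B - \dim A)%N.
Proof.
move=> AB; rewrite -(limg_ker_dim f A) -(limg_ker_dim f B).
have kAB : (\dim (A :&: lker f) <= \dim (B :&: lker f))%N.
  by apply: dimvS; exact: capvS.
have fAB : (\dim (f @: A) <= \dim (f @: B))%N by exact/dimvS/limgS.
by lia.
Qed.

(** * Counting the intervals of a class that contain a given interval *)

Section UpperSets.
Variables (R : realType) (K : fieldType).

(** Larger intervals come first in a class, so these elements form an initial segment of the class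
    of [I]; comparing their numbers compares positions. *)
Definition up_set (r : ivl R -> ivl R -> Prop) (M : pfdmod R K) (I : ivl R) :
  set (barc M) := [set b | r I (bc_ivl b) /\ iset I `<=` iset (bc_ivl b)].

Lemma up_set_seq r (M : pfdmod R K) I : exists q : seq {classic barc M},
  uniq q /\ forall b, b \in q <-> up_set r I b.
Proof.
have [t It] := ivl_neq0 I; have [q [uq qP]] := barc_seq M t.
exists [seq b <- q | `[< up_set r I b >]]; split; first exact: filter_uniq.
move=> b; rewrite mem_filter; split=> [/andP[/asboolP]//|Ub].
apply/andP; split; first exact/asboolP.
by apply/qP; apply: Ub.2.
Qed.

Lemma barc_seq2 (M : pfdmod R K) (s t : R) : exists q : seq {classic barc M},
  uniq q /\ forall b, b \in q <-> iset (bc_ivl b) s /\ iset (bc_ivl b) t.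
Proof.
have [q [uq qP]] := barc_seq M s.
exists [seq b <- q | `[< iset (bc_ivl b) t >]]; split; first exact: filter_uniq.
move=> b; rewrite mem_filter; split=> [/andP[/asboolP bt /qP//]|[bs bt]].
by apply/andP; split; [exact/asboolP|exact/qP].
Qed.

End UpperSets.

Section UpperSetCardinals.
Variables (R : realType) (K : fieldType).
Implicit Types M N : pfdmod R K.

Let civl M (b : {classic barc M}) : {classic ivl R} := bc_ivl b.

Let rank M (s t : R) := \dim (limg (pmor (pmod_of M) s t)).

(** The rank counts the intervals containing [s] and [t], which by the cut are those containing [I];
    those not related to [I] are subtracted. *)
Lemma up_set_size r M (I : ivl R) (s t : R) (q e : seq {classic barc M}) :
  iset I s -> iset I t -> s <= t ->
  (forall b : barc M, iset (bc_ivl b) s -> iset (bc_ivl b) t ->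
     iset I `<=` iset (bc_ivl b)) ->
  uniq q -> (forall b, b \in q <-> up_set r I b) ->
  uniq e -> (forall b, b \in e <->
     iset I `<=` iset (bc_ivl b) /\ ~ r I (bc_ivl b)) ->
  size q = (rank M s t - size e)%N.
Proof.
move=> Is It st cut uq qP ue eP; have [a [ua aP]] := barc_seq2 M s t.
rewrite /rank -(barc_rank st ua aP); apply: size_subset_diff => // b.
  by move=> /eP[Ib _]; apply/aP; split; exact: Ib.
apply/idP/andP => [/qP[rb Ib]|[/aP[bs bt] /negP be]].
  by split; [apply/aP; split; exact: Ib|apply/negP => /eP[]].
have Ib := cut _ bs bt; apply/qP; split=> //.
by apply: contrapT => nrb; apply: be; apply/eP.
Qed.

(** The cut is made for the intervals of both modules at once, so that the same pair of indices
    serves for [M] and [N]. *)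
Lemma exists_inner_cut M N (I : ivl R) : exists s t : R,
  [/\ iset I s, iset I t, s <= t,
    forall b : barc M, iset (bc_ivl b) s -> iset (bc_ivl b) t ->
      iset I `<=` iset (bc_ivl b) &
    forall b : barc N, iset (bc_ivl b) s -> iset (bc_ivl b) t ->
      iset I `<=` iset (bc_ivl b)].
Proof.
have [t0 It0] := ivl_neq0 I.
have [qM [_ qMP]] := barc_seq M t0; have [qN [_ qNP]] := barc_seq N t0.
have [s [t [Is It st0 t0t cut]]] := @finite_inner_cut _ I
  (map (@civl _) qM ++
   map (@civl _) qN) t0 It0.
exists s, t; split=> // [|b bs bt|b bs bt]; first exact: le_trans st0 t0t.
- apply: (cut _ _ bs bt); rewrite mem_cat; apply/orP; left.
  apply: (map_f (@civl _)); apply/qMP.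
  exact: ivl_between bs bt st0 t0t.
- apply: (cut _ _ bs bt); rewrite mem_cat; apply/orP; right.
  apply: (map_f (@civl _)); apply/qNP.
  exact: ivl_between bs bt st0 t0t.
Qed.

Let barcs_meeting M N (I : ivl R) : exists l : seq {classic ivl R},
  (forall b : barc M, iset I `<=` iset (bc_ivl b) ->
    (bc_ivl b : {classic _}) \in l) /\
  (forall b : barc N, iset I `<=` iset (bc_ivl b) ->
    (bc_ivl b : {classic _}) \in l).
Proof.
have [t It] := ivl_neq0 I.
have [qM [_ qMP]] := barc_seq M t; have [qN [_ qNP]] := barc_seq N t.
exists (map (@civl _) qM ++
   map (@civl _) qN); split=> b Ib;
  rewrite mem_cat; apply/orP; [left|right];
  apply: (map_f (@civl _)).
- by apply/qMP/Ib.
- by apply/qNP/Ib.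
Qed.

(** The number sought is the dimension of the part of the image from [s] to [t] killed on the way to
    [u]; [f] embeds this space for [M] into the one for [N]. *)
Lemma up_set_mono M N (f : @mor (pfdmod R K) M N) (I : ivl R)
    (qM : seq {classic barc M}) (qN : seq {classic barc N}) : is_mono f ->
  uniq qM -> (forall b, b \in qM <-> up_set (@coincide_above R) I b) ->
  uniq qN -> (forall b, b \in qN <-> up_set (@coincide_above R) I b) ->
  (size qM <= size qN)%N.
Proof.
move=> f_mono uM qMP uN qNP.
have [s [t [Is It st cutM cutN]]] := exists_inner_cut M N I.
have [l [lM lN]] := barcs_meeting M N I.
have [o [oI ol]] := finite_upper_cut I l.
have fker0 x : (lker (ncomp f x) == 0)%VS.
  rewrite -subv0; apply/subvP => v; rewrite memv_ker memv0 => /eqP fv.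
  by apply/eqP; exact: mono_injective f_mono fv.
have flimg x y : x <= y ->
    (ncomp f y @: limg (pmor (pmod_of M) x y) <=
     limg (pmor (pmod_of N) x y))%VS.
  move=> xy; apply/subvP => _ /memv_imgP[_ /memv_imgP[v _ ->] ->].
  by rewrite ncomp_pmor// memv_img ?memvf.
have fdim x (A : {vspace M x}) : \dim (ncomp f x @: A) = \dim A.
  by apply: limg_dim_eq; rewrite (eqP (fker0 x)) capv0.
(* Without a cut index, all intervals of [M] and [N] containing [I] coincide above with it, and the
   ranks themselves are compared. *)
case: o oI ol => [u|] oI ol; last first.
  rewrite (up_set_size (e := [::]) Is It st cutM uM qMP)//; last first.
    move=> b; split=> // -[Ib]; case; exact/(ol _ (lM b Ib) Ib).
  rewrite (up_set_size (e := [::]) Is It st cutN uN qNP)//; last first.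
    move=> b; split=> // -[Ib]; case; exact/(ol _ (lN b Ib) Ib).
  rewrite !subn0 /rank -[X in (X <= _)%N](fdim t).
  exact/dimvS/flimg.
have tu : t <= u by exact: oI.
have [eM [ueM eMP]] := barc_seq2 M s u; have [eN [ueN eNP]] := barc_seq2 N s u.
have su := le_trans st tu.
rewrite (up_set_size Is It st cutM uM qMP ueM); last first.
  move=> b; split=> [/eMP[bs bu]|[Ib nr]].
    have Ib := cutM _ bs (ivl_between bs bu st tu).
    by split=> // /(ol _ (lM b Ib) Ib).
  apply/eMP; split; first exact: Ib.
  by apply: contrapT => nbu; apply/nr/(ol _ (lM b Ib) Ib).
rewrite (up_set_size Is It st cutN uN qNP ueN); last first.
  move=> b; split=> [/eNP[bs bu]|[Ib nr]].
    have Ib := cutN _ bs (ivl_between bs bu st tu).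
    by split=> // /(ol _ (lN b Ib) Ib).
  apply/eNP; split; first exact: Ib.
  by apply: contrapT => nbu; apply/nr/(ol _ (lN b Ib) Ib).
rewrite (barc_rank su ueM eMP) (barc_rank su ueN eNP) /rank.
(* Rank-nullity on the image turns the difference of two ranks into the dimension of one
   subspace. *)
have ker_dim X : (\dim (limg (pmor (pmod_of X) s t)) -
    \dim (limg (pmor (pmod_of X) s u)))%N =
    \dim (limg (pmor (pmod_of X) s t) :&: lker (pmor (pmod_of X) t u)).
  have <- : (pmor (pmod_of X) t u @: limg (pmor (pmod_of X) s t))%VS =
      limg (pmor (pmod_of X) s u).
    rewrite -limg_comp; congr (lfun_img _ _); apply/lfunP => v.
    by rewrite comp_lfunE; exact: pmorM st tu.
  by rewrite -(limg_ker_dim (pmor (pmod_of X) t u)) addnK.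
rewrite !ker_dim -[X in (X <= _)%N](fdim t); apply: dimvS.
apply/subvP => _ /memv_imgP[v vA ->]; move: vA; rewrite !memv_cap !memv_ker.
move=> /andP[vlim /eqP v0]; apply/andP; split.
  by apply: (subvP (flimg _ _ st)); exact: memv_img.
by rewrite -ncomp_pmor// v0 linear0.
Qed.

(** The number sought is the codimension of the image from [v] in the image from [s], both at [t]. A
    surjective [f] maps images onto images and cannot increase this codimension. *)
Lemma up_set_epi M N (f : @mor (pfdmod R K) M N) (I : ivl R)
    (qM : seq {classic barc M}) (qN : seq {classic barc N}) : is_epi f ->
  uniq qM -> (forall b, b \in qM <-> up_set (@coincide_below R) I b) ->
  uniq qN -> (forall b, b \in qN <-> up_set (@coincide_below R) I b) ->
  (size qN <= size qM)%N.
Proof.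
move=> f_epi uM qMP uN qNP.
have [s [t [Is It st cutM cutN]]] := exists_inner_cut M N I.
have [l [lM lN]] := barcs_meeting M N I.
have [o [oI ol]] := finite_lower_cut I l.
have flimg x y : x <= y ->
    (ncomp f y @: limg (pmor (pmod_of M) x y))%VS =
     limg (pmor (pmod_of N) x y).
  move=> xy; rewrite -(epi_surjective x f_epi) -!limg_comp.
  congr (lfun_img _ _); apply/lfunP => v; rewrite [LHS]lfunE [RHS]lfunE /=.
  exact: ncomp_pmor.
case: o oI ol => [v|] oI ol; last first.
  rewrite (up_set_size (e := [::]) Is It st cutM uM qMP)//; last first.
    move=> b; split=> // -[Ib]; case; exact/(ol _ (lM b Ib) Ib).
  rewrite (up_set_size (e := [::]) Is It st cutN uN qNP)//; last first.
    move=> b; split=> // -[Ib]; case; exact/(ol _ (lN b Ib) Ib).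
  by rewrite !subn0 /rank -flimg// -(limg_ker_dim (ncomp f t)) leq_addl.
have vs : v <= s by exact: oI.
have [eM [ueM eMP]] := barc_seq2 M v t; have [eN [ueN eNP]] := barc_seq2 N v t.
have vt := le_trans vs st.
rewrite (up_set_size Is It st cutM uM qMP ueM); last first.
  move=> b; split=> [/eMP[bv bt]|[Ib nr]].
    have Ib := cutM _ (ivl_between bv bt vs st) bt.
    by split=> // /(ol _ (lM b Ib) Ib).
  apply/eMP; split; last exact: Ib.
  by apply: contrapT => nbv; apply/nr/(ol _ (lM b Ib) Ib).
rewrite (up_set_size Is It st cutN uN qNP ueN); last first.
  move=> b; split=> [/eNP[bv bt]|[Ib nr]].
    have Ib := cutN _ (ivl_between bv bt vs st) bt.
    by split=> // /(ol _ (lN b Ib) Ib).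
  apply/eNP; split; last exact: Ib.
  by apply: contrapT => nbv; apply/nr/(ol _ (lN b Ib) Ib).
rewrite (barc_rank vt ueM eMP) (barc_rank vt ueN eNP) /rank -!flimg//.
by apply: limg_codim; exact: (@limg_pmorS _ _ (pmod_of M) t v s vs st).
Qed.

End UpperSetCardinals.

(** * Induced matchings *)

(** Induction on the size, removing the largest element [m]: it comes after all others, so removal
    does not change their predecessors. *)
Lemma exists_nth_of_total (T : eqType) (lt : T -> T -> Prop) (q : seq T) i :
  (forall x, ~ lt x x) ->
  (forall x y z, x \in q -> y \in q -> z \in q -> lt x y -> lt y z -> lt x z) ->
  (forall x y, x \in q -> y \in q -> x <> y -> lt x y \/ lt y x) ->
  uniq q -> (i < size q)%N ->
  exists2 c, c \in q & exists p, [/\ uniq p, size p = i &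
    forall x, x \in p <-> x \in q /\ lt x c].
Proof.
move=> irr; move En : (size q) => n.
elim: n q En i => // n IHn q qn i tr tot uq.
have [m mq mmax] : exists2 m, m \in q & forall x, x \in q -> x <> m -> lt x m.
  have : q != [::] by rewrite -size_eq0 qn.
  elim: q {qn uq IHn} tr tot => // a q IHq tr tot _.
  have [->|q0] := eqVneq q [::].
    by exists a => [|x]; rewrite ?mem_head// inE => /eqP ->.
  have [| |//|m mq mmax] := IHq.
  - by move=> x y z xq yq zq; apply: tr; rewrite in_cons ?xq ?yq ?zq orbT.
  - by move=> x y xq yq; apply: tot; rewrite in_cons ?xq ?yq orbT.
  have maq : m \in a :: q by rewrite in_cons mq orbT.
  have [am|am] := pselect (a = m).
    exists m => // x; rewrite in_cons => /orP[/eqP ->//|]; exact: mmax.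
  have [a_m|m_a] := tot _ _ (mem_head a q) maq am.
    exists m => // x; rewrite in_cons => /orP[/eqP ->//|]; exact: mmax.
  exists a; first exact: mem_head.
  move=> x; rewrite in_cons => /orP[/eqP ->//|xq] _.
  have [->//|xm] := pselect (x = m).
  apply: (tr x m a) (mmax _ xq xm) m_a => //; last exact: mem_head.
  by rewrite in_cons xq orbT.
have rem_sub x : x \in rem m q -> x \in q by exact: mem_rem.
have size_r : size (rem m q) = n by rewrite size_rem// qn.
(* Positions start at 0, so the last one, [n], belongs to [m], whose predecessors are all the
   remaining elements. *)
rewrite ltnS leq_eqVlt => /orP[/eqP ->|i_n].
  exists m => //; exists (rem m q); split; rewrite ?rem_uniq// => x.
  rewrite mem_rem_uniq// inE; split=> [/andP[/eqP xm xq]|[xq xm]].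
    by split=> //; exact: mmax.
  by rewrite xq andbT; apply/eqP => xE; apply: (irr m); rewrite -{1}xE.
have [| | |//|c cr [p [up pi pP]]] := IHn _ size_r i.
- by move=> x y z /rem_sub xq /rem_sub yq /rem_sub zq; exact: tr.
- by move=> x y /rem_sub xq /rem_sub yq; exact: tot.
- exact: rem_uniq.
exists c; first exact: rem_sub.
exists p; split=> // x; split=> [/pP[/rem_sub xq xc]//|[xq xc]].
apply/pP; split=> //; rewrite mem_rem_uniq// inE xq andbT.
move: cr; rewrite mem_rem_uniq// inE => /andP[/eqP cm cq].
apply/eqP => xm; apply: (irr c); apply: (tr c m c) => //.
  exact: mmax.
by rewrite -xm.
Qed.

(** What coinciding above and coinciding below have in common; nestedness makes the order on each
    class total. *)
Definition nested_equivalence (R : realType) (r : ivl R -> ivl R -> Prop) :=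
  [/\ forall I, r I I, forall I J, r I J -> r J I,
    forall I J L, r I J -> r J L -> r I L
    & forall I J, r I J -> iset I `<=` iset J \/ iset J `<=` iset I].

Section InducedMatching.
Variables (R : realType) (K : fieldType) (r : ivl R -> ivl R -> Prop).
Hypothesis r_nested_equivalence : nested_equivalence r.

Let r_refl I : r I I. Proof. by case: r_nested_equivalence. Qed.
Let r_sym I J : r I J -> r J I.
Proof. by case: r_nested_equivalence => _ + _ _; exact. Qed.
Let r_trans I J L : r I J -> r J L -> r I L.
Proof. by case: r_nested_equivalence => _ _ + _; exact. Qed.
Let r_nested I J : r I J -> iset I `<=` iset J \/ iset J `<=` iset I.
Proof. by case: r_nested_equivalence => _ _ _; exact. Qed.

Implicit Types M N P : pfdmod R K.

Lemma ivlP (I J : ivl R) : iset I = iset J -> I = J.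
Proof.
case: I => I I0 Ii; case: J => J J0 Ji /= IJ; subst J.
by congr Ivl; exact: Prop_irrelevance.
Qed.

Lemma barc_eltE M (b : barc M) : sval b = (bc_ivl b, (sval b).2).
Proof. by case: b => -[]. Qed.

Lemma elt_ltE M (b c : barc M) : elt_lt b c <->
  iset (bc_ivl c) `<` iset (bc_ivl b) \/
  bc_ivl b = bc_ivl c /\ ((sval b).2 < (sval c).2)%N.
Proof. by rewrite /elt_lt /bc_ivl; case: b c => -[I m] ? [[J n] ?]. Qed.

Lemma elt_lt_sub M (b c : barc M) :
  elt_lt b c -> iset (bc_ivl c) `<=` iset (bc_ivl b).
Proof. by move=> /elt_ltE[[]//|[-> _]]. Qed.

Lemma elt_lt_irr M (b : barc M) : ~ elt_lt b b.
Proof. by move=> /elt_ltE[[]//|[_]]; rewrite ltnn. Qed.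

Lemma elt_lt_trans M (b c d : barc M) :
  elt_lt b c -> elt_lt c d -> elt_lt b d.
Proof.
move=> /elt_ltE[bc|[bcE bc]] /elt_ltE[cd|[cdE cd]]; apply/elt_ltE.
- by left; split; [exact: subset_trans cd.1 bc.1|
    move=> bd; apply: cd.2; exact: subset_trans bc.1 bd].
- by left; rewrite -cdE.
- by left; rewrite bcE.
- by right; rewrite bcE cdE; split=> //; exact: ltn_trans cd.
Qed.

Lemma elt_lt_total M (b c : barc M) : r (bc_ivl b) (bc_ivl c) ->
  b <> c -> elt_lt b c \/ elt_lt c b.
Proof.
move=> rbc bc; have [E|bcN] := pselect (iset (bc_ivl b) = iset (bc_ivl c)).
  have bcE := ivlP E.
  have [lt|gt|eq] := ltngtP (sval b).2 (sval c).2.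
  - by left; apply/elt_ltE; right.
  - by right; apply/elt_ltE; right.
  - case: bc; apply: sval_injective.
    by rewrite (barc_eltE b) (barc_eltE c) eq bcE.
have [sub|sub] := r_nested rbc; [right|left]; apply/elt_ltE; left.
  by split=> // sub'; apply: bcN; apply/seteqP.
by split=> // sub'; apply: bcN; apply/seteqP.
Qed.

(** The cardinality of the set of predecessors is replaced by a duplicate-free list, whose size can
    be compared. *)
Lemma is_nthP M (e : set (ivl R)) i (b : barc M) : is_nth e i b <->
  e (bc_ivl b) /\ exists p : seq {classic barc M}, [/\ uniq p, size p = i &
    forall c, c \in p <-> e (bc_ivl c) /\ elt_lt c b].
Proof.
split=> -[eb].
  move=> cardi; split=> //.
  have /(@finite_fsetP {classic barc M})[X XE] :
      finite_set [set c | class_elts e c /\ elt_lt c b].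
    by apply/finite_setP; exists i.
  exists X; split=> [||c]; first exact: fset_uniq.
    by apply: (elimT (@card_eq_fsetP _ X i)); rewrite -XE.
  by move/seteqP : XE => [XE1 XE2]; split=> [/XE2|/XE1].
move=> [p [up pi pP]]; split=> //.
rewrite (_ : [set c | _] = [set` [fset c in p]%fset]).
  apply: (introT (@card_eq_fsetP _ [fset c in p]%fset i)).
  by rewrite card_fseq undup_id.
by apply/seteqP; split=> c /=; rewrite !inE => /pP.
Qed.

Lemma is_class_of (e : set (ivl R)) (I J : ivl R) :
  is_class r e -> e I -> e J <-> r I J.
Proof.
move=> [L ->] /= LI; split=> [LJ|IJ]; last exact: r_trans LI IJ.
by apply: r_trans LJ; exact: r_sym.
Qed.

Lemma is_class_eq (e e' : set (ivl R)) (I : ivl R) :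
  is_class r e -> is_class r e' -> e I -> e' I -> e = e'.
Proof.
move=> re re' eI e'I; apply/seteqP; split=> J.
  by move=> /(is_class_of _ re eI)/(is_class_of _ re' e'I).
by move=> /(is_class_of _ re' e'I)/(is_class_of _ re eI).
Qed.

(** Of two distinct elements one precedes the other; the later one then has the earlier one and all
    its predecessors before it, so its position is larger. *)
Lemma is_nth_inj M e i (b c : barc M) : is_class r e ->
  is_nth e i b -> is_nth e i c -> b = c.
Proof.
move=> re /is_nthP[eb [p [up pi pP]]] /is_nthP[ec [q [uq qi qP]]].
have no_lt (b' c' : barc M) (p' q' : seq {classic barc M}) :
    uniq p' -> size p' = size q' -> e (bc_ivl b') ->
    (forall d, d \in p' <-> e (bc_ivl d) /\ elt_lt d b') ->
    (forall d, d \in q' <-> e (bc_ivl d) /\ elt_lt d c') -> ~ elt_lt b' c'.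
  move=> up' pq' eb' p'P q'P b'c'.
  have ubp : uniq ((b' : {classic _}) :: p').
    by rewrite /= up' andbT; apply/negP => /p'P[_]; exact: elt_lt_irr.
  suff /(uniq_leq_size ubp) : {subset (b' : {classic _}) :: p' <= q'}.
    by rewrite /= pq' ltnn.
  move=> d.
  rewrite in_cons => /orP[/eqP ->|/p'P[ed db']]; apply/q'P; split=> //.
  exact: elt_lt_trans b'c'.
apply: contrapT => bc.
have [lt|lt] := elt_lt_total ((is_class_of _ re eb).1 ec) bc.
  by apply: (no_lt b c p q) => //; rewrite pi qi.
by apply: (no_lt c b q p) => //; rewrite pi qi.
Qed.

Lemma is_nth_index M e i j (b : barc M) :
  is_nth e i b -> is_nth e j b -> i = j.
Proof.
move=> /is_nthP[_ [p [up <- pP]]] /is_nthP[_ [q [uq <- qP]]].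
apply/perm_size/uniq_perm => // c.
by apply/idP/idP => [/pP/qP|/qP/pP].
Qed.

(** All predecessors of [b] have intervals containing that of [b], so there are finitely many. *)
Lemma is_nth_exists M e (b : barc M) :
  is_class r e -> e (bc_ivl b) -> exists i, is_nth e i b.
Proof.
move=> re eb; have [q [uq qP]] := up_set_seq r M (bc_ivl b).
exists (size [seq c <- q | `[< elt_lt (c : barc M) b >]]).
apply/is_nthP; split=> //; exists [seq c <- q | `[< elt_lt (c : barc M) b >]].
split=> // [|c]; first exact: filter_uniq.
rewrite mem_filter; split.
  move=> /andP[/asboolP cb /qP[rbc _]]; split=> //.
  exact/(is_class_of _ re eb).
move=> [ec cb]; apply/andP; split; first exact/asboolP.
apply/qP; split; first exact/(is_class_of _ re eb).
exact: elt_lt_sub.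
Qed.

(** Being matched means having the same class and the same position. Hence the relation is
    symmetric, reflexive and transitive across modules, which gives functionality, injectivity and
    the functor laws. *)
Lemma induced_by_sym M N (b : barc M) (c : barc N) :
  induced_by r b c -> induced_by r c b.
Proof. by move=> [e [i [re bi ci]]]; exists e, i. Qed.

Lemma induced_by_refl M (b : barc M) : induced_by r b b.
Proof.
have rb : is_class r [set L | r (bc_ivl b) L] by exists (bc_ivl b).
have [i bi] := is_nth_exists rb (r_refl (bc_ivl b)).
by exists [set L | r (bc_ivl b) L], i.
Qed.

Lemma induced_by_trans M N P (b : barc M) (c : barc N) (d : barc P) :
  induced_by r b c -> induced_by r c d -> induced_by r b d.
Proof.
move=> [e [i [re bi ci]]] [e' [j [re' cj dj]]]; exists e, i; split=> //.
have ee' : e = e' by apply: is_class_eq re re' ci.1 cj.1.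
by subst e'; rewrite (is_nth_index ci cj).
Qed.

Lemma induced_by_diag M (b c : barc M) : induced_by r b c -> b = c.
Proof. by move=> [e [i [re bi ci]]]; exact: is_nth_inj bi ci. Qed.

Lemma induced_by_functional M N (b : barc M) (c c' : barc N) :
  induced_by r b c -> induced_by r b c' -> c = c'.
Proof.
by move=> bc bc'; exact/induced_by_diag/induced_by_trans/bc'/induced_by_sym.
Qed.

Lemma induced_by_injective M N (b b' : barc M) (c : barc N) :
  induced_by r b c -> induced_by r b' c -> b = b'.
Proof.
move=> /induced_by_sym bc /induced_by_sym b'c.
exact: induced_by_functional b'c.
Qed.

Section Total.
Variables M N : pfdmod R K.
Hypothesis up_set_le : forall (I : ivl R) (qM : seq {classic barc M})
    (qN : seq {classic barc N}),
  uniq qM -> (forall b, b \in qM <-> up_set r I b) ->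
  uniq qN -> (forall b, b \in qN <-> up_set r I b) ->
  (size qM <= size qN)%N.

(** The partner is sought among the elements of [N] whose intervals contain that of [b]: by the
    count there are enough of them, and as an initial segment of the class they keep their
    positions. *)
Lemma induced_by_total (b : barc M) : exists c : barc N,
  [/\ induced_by r b c, r (bc_ivl b) (bc_ivl c)
    & iset (bc_ivl b) `<=` iset (bc_ivl c)].
Proof.
have [e [i [re bi _]]] := induced_by_refl b.
have [qM [uM qMP]] := up_set_seq r M (bc_ivl b).
have [qN [uN qNP]] := up_set_seq r N (bc_ivl b).
have /is_nthP[eb [p [up pi pP]]] := bi.
(* [b] and its [i] predecessors all lie in [qM], which gives the strict inequality. *)
have iM : (i < size qM)%N.
  have ubp : uniq ((b : {classic _}) :: p).
    by rewrite /= up andbT; apply/negP => /pP[_]; exact: elt_lt_irr.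
  have := @uniq_leq_size _ ((b : {classic _}) :: p) qM ubp.
  rewrite /= pi; apply=> c; rewrite in_cons => /orP[/eqP ->|/pP[ec cb]].
    by apply/qMP; split.
  by apply/qMP; split; [exact/(is_class_of _ re eb)|exact: elt_lt_sub].
have iN := leq_trans iM (up_set_le uM qMP uN qNP).
have [|||c cq [q [uq qi qP]]] :=
  @exists_nth_of_total {classic barc N} (@elt_lt R K N) qN i _ _ _ uN iN.
- exact: elt_lt_irr.
- by move=> x y z _ _ _; exact: elt_lt_trans.
- move=> x y /qNP[rx _] /qNP[ry _]; apply: elt_lt_total.
  exact: r_trans (r_sym rx) ry.
have [rbc bc] := (qNP c).1 cq; exists c; split=> //.
have ec : e (bc_ivl c) by apply/(is_class_of _ re eb).
(* A predecessor of [c] in the class has an interval containing that of [c], hence lies in [qN]; so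
   [c] has the same position in the whole class. *)
exists e, i; split=> //; apply/is_nthP; split=> //; exists q; split=> // d.
split=> [/qP[/qNP[rbd _] dc]|[ed dc]].
  by split=> //; apply/(is_class_of _ re eb).
apply/qP; split=> //; apply/qNP; split; first exact/(is_class_of _ re eb).
exact: subset_trans bc (elt_lt_sub dc).
Qed.

Lemma induced_by_sub (b : barc M) (c : barc N) : induced_by r b c ->
  r (bc_ivl b) (bc_ivl c) /\ iset (bc_ivl b) `<=` iset (bc_ivl c).
Proof.
move=> bc; have [c' [bc' rbc sub]] := induced_by_total b.
by rewrite (induced_by_functional bc bc').
Qed.

End Total.

End InducedMatching.

(** * Functoriality *)

Section CoincideRelations.
Variable R : realType.
Implicit Types I J L : ivl R.

Lemma coincide_above_refl I : coincide_above I I.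
Proof. by split=> s Is; exists s. Qed.

Lemma coincide_above_sym I J : coincide_above I J -> coincide_above J I.
Proof. by case. Qed.

Lemma bounds_above_trans I J L :
  bounds_above I J -> bounds_above J L -> bounds_above I L.
Proof.
move=> IJ JL s /JL[t /IJ[u Iu tu] st]; exists u => //; exact: le_trans tu.
Qed.

Lemma coincide_above_trans I J L :
  coincide_above I J -> coincide_above J L -> coincide_above I L.
Proof.
move=> [IJ JI] [JL LJ].
by split; [exact: bounds_above_trans JL|exact: bounds_above_trans JI].
Qed.

(** A point of [I] missing from [J] lies below all of [J], since [J] reaches as high as [I]; then
    every point of [J] lies between two points of [I]. *)
Lemma coincide_above_nested I J : coincide_above I J ->
  iset I `<=` iset J \/ iset J `<=` iset I.
Proof.
move=> [IJ JI]; have [|/existsNP[x /not_implyP[Ix nJx]]] :=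
  pselect (iset I `<=` iset J); [by left|right=> y Jy].
have [xy|/ltW yx] := leP x y.
  by have [t It yt] := IJ _ Jy; exact: ivl_between Ix It xy yt.
by have [t Jt xt] := JI _ Ix; case: nJx; exact: ivl_between Jy Jt yx xt.
Qed.

Lemma coincide_below_refl I : coincide_below I I.
Proof. by split=> s Is; exists s. Qed.

Lemma coincide_below_sym I J : coincide_below I J -> coincide_below J I.
Proof. by case. Qed.

Lemma bounds_below_trans I J L :
  bounds_below I J -> bounds_below J L -> bounds_below I L.
Proof.
move=> IJ JL s /JL[t /IJ[u Iu ut] ts]; exists u => //; exact: le_trans ts.
Qed.

Lemma coincide_below_trans I J L :
  coincide_below I J -> coincide_below J L -> coincide_below I L.
Proof.
move=> [IJ JI] [JL LJ].
by split; [exact: bounds_below_trans JL|exact: bounds_below_trans JI].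
Qed.

Lemma coincide_below_nested I J : coincide_below I J ->
  iset I `<=` iset J \/ iset J `<=` iset I.
Proof.
move=> [IJ JI]; have [|/existsNP[x /not_implyP[Ix nJx]]] :=
  pselect (iset I `<=` iset J); [by left|right=> y Jy].
have [xy|/ltW yx] := leP x y.
  by have [t Jt tx] := JI _ Ix; case: nJx; exact: ivl_between Jt Jy tx xy.
by have [t It ty] := IJ _ Jy; exact: ivl_between It Ix ty yx.
Qed.

(** Enlarging the target without changing its upper end keeps the overlap. Hence composing with the
    matching of a monomorphism truncates nothing. *)
Lemma overlaps_above_subl I J L : overlaps_above I J ->
  coincide_above J L -> iset J `<=` iset L -> overlaps_above I L.
Proof.
move=> [[x [Ix Jx]] IJ JI] [JL _] sub; split.
- by exists x; split=> //; exact: sub.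
- exact: bounds_above_trans JL.
- by move=> t /JI[s Js st]; exists s => //; exact: sub.
Qed.

Lemma overlaps_above_subr I J L : overlaps_above I J ->
  coincide_below I L -> iset I `<=` iset L -> overlaps_above L J.
Proof.
move=> [[x [Ix Jx]] IJ JI] [IL _] sub; split.
- by exists x; split=> //; exact: sub.
- by move=> s /IJ[t It st]; exists t => //; exact: sub.
- exact: bounds_below_trans IL.
Qed.

Lemma coincide_above_overlaps I J : coincide_above I J ->
  iset I `<=` iset J -> overlaps_above I J.
Proof. exact/overlaps_above_subl/overlaps_above_refl. Qed.

Lemma coincide_below_overlaps I J : coincide_below I J ->
  iset I `<=` iset J -> overlaps_above J I.
Proof. exact/overlaps_above_subr/overlaps_above_refl. Qed.

Lemma coincide_above_equivalence : nested_equivalence (@coincide_above R).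
Proof.
split; [exact: coincide_above_refl|exact: coincide_above_sym|
  exact: coincide_above_trans|exact: coincide_above_nested].
Qed.

Lemma coincide_below_equivalence : nested_equivalence (@coincide_below R).
Proof.
split; [exact: coincide_below_refl|exact: coincide_below_sym|
  exact: coincide_below_trans|exact: coincide_below_nested].
Qed.

End CoincideRelations.

(** * The functor on monomorphisms *)

Section MonoMatching.
Variables (R : realType) (K : fieldType).

Let rP := @coincide_above_equivalence R.

Section Mono.
Variables (M N : mono_cat (pfdmod R K)) (f : mor M N).

Lemma induced_mono_total (b : barc M) : exists c : barc N, induced_mono f b c.
Proof.
have [|c [bc _ _]] := @induced_by_total R K _ rP M N _ b; last by exists c.
move=> I qM qN uM qMP uN qNP; exact: (up_set_mono (svalP f) uM qMP uN qNP).
Qed.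

Lemma induced_mono_sub (b : barc M) (c : barc N) : induced_mono f b c ->
  coincide_above (bc_ivl b) (bc_ivl c) /\
  iset (bc_ivl b) `<=` iset (bc_ivl c).
Proof.
apply: (@induced_by_sub R K _ rP M N) => I qM qN uM qMP uN qNP.
exact: (up_set_mono (svalP f) uM qMP uN qNP).
Qed.

Lemma induced_mono_functional (b : barc M) (c c' : barc N) :
  induced_mono f b c -> induced_mono f b c' -> c = c'.
Proof. exact: (induced_by_functional rP). Qed.

Lemma induced_mono_injective (b b' : barc M) (c : barc N) :
  induced_mono f b c -> induced_mono f b' c -> b = b'.
Proof. exact: (induced_by_injective rP). Qed.

Lemma induced_mono_overlaps (b : barc M) (c : barc N) :
  induced_mono f b c -> overlaps_above (bc_ivl b) (bc_ivl c).
Proof. by move=> /induced_mono_sub[]; exact: coincide_above_overlaps. Qed.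

Definition mono_matching : overlap_matching (barc M) (barc N) :=
  OverlapMatching induced_mono_functional induced_mono_injective
    induced_mono_overlaps.

(** The matching is total and injective and composing with it discards no pair, so a pair of [g] can
    be recovered from the composite. *)
Lemma mono_matching_mono : @is_mono (Barc R) (barc M) (barc N) mono_matching.
Proof.
have sub (Z : barcode R) (g h : overlap_matching Z (barc M)) :
    om_comp mono_matching g = om_comp mono_matching h ->
    forall z b, g z b -> h z b.
  move=> gh z b gzb; have [c bc] := induced_mono_total b.
  have [rbc bc_sub] := induced_mono_sub bc.
  have : om_comp mono_matching g z c.
    split; first by exists b.
    exact: overlaps_above_subl (om_overlap gzb) rbc bc_sub.
  rewrite gh => -[[b' [hzb' b'c]] _].
  by rewrite (induced_mono_injective bc b'c).
move=> Z g h gh; apply: overlap_matchingP => z b.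
by split; apply: sub.
Qed.

End Mono.

Lemma mono_matching_functor : exists X : forall M N : mono_cat (pfdmod R K),
    mor M N -> @mor (mono_cat (Barc R)) (barc M) (barc N),
  (forall M N (f : mor M N), omrel (sval (X M N f)) = induced_mono f) /\
  is_functor X.
Proof.
exists (fun M N f => exist _ (mono_matching f) (@mono_matching_mono M N f)).
split=> //; split=> [M|M N P g f]; apply: sval_injective;
  apply: overlap_matchingP => b c; split.
- exact: (induced_by_diag rP).
- by move=> ->; exact: (induced_by_refl rP).
(* Totality of the first matching supplies the middle element [d]; symmetry and transitivity then
   match [d] with [c]. *)
- move=> bc; split; last exact: (@induced_mono_overlaps M P (cmor g f)).
  have [d bd] := induced_mono_total f b; exists d; split=> //.
  exact: (induced_by_trans rP (induced_by_sym bd) bc).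
- by move=> [[d [bd dc]] _]; exact: (induced_by_trans rP bd dc).
Qed.

End MonoMatching.

(** * The functor on epimorphisms *)

Section EpiMatching.
Variables (R : realType) (K : fieldType).

Let rP := @coincide_below_equivalence R.

Section Epi.
Variables (M N : epi_cat (pfdmod R K)) (f : mor M N).

(** The inequality of counts goes from [N] to [M], so totality is applied with the modules exchanged
    and read backwards. *)
Lemma induced_epi_total (c : barc N) : exists b : barc M, induced_epi f b c.
Proof.
have [|b [cb _ _]] := @induced_by_total R K _ rP N M _ c.
  move=> I qN qM uN qNP uM qMP; exact: (up_set_epi (svalP f) uM qMP uN qNP).
by exists b; exact: induced_by_sym cb.
Qed.

Lemma induced_epi_sub (b : barc M) (c : barc N) : induced_epi f b c ->
  coincide_below (bc_ivl c) (bc_ivl b) /\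
  iset (bc_ivl c) `<=` iset (bc_ivl b).
Proof.
move=> /induced_by_sym; apply: (@induced_by_sub R K _ rP N M).
move=> I qN qM uN qNP uM qMP; exact: (up_set_epi (svalP f) uM qMP uN qNP).
Qed.

Lemma induced_epi_functional (b : barc M) (c c' : barc N) :
  induced_epi f b c -> induced_epi f b c' -> c = c'.
Proof. exact: (induced_by_functional rP). Qed.

Lemma induced_epi_injective (b b' : barc M) (c : barc N) :
  induced_epi f b c -> induced_epi f b' c -> b = b'.
Proof. exact: (induced_by_injective rP). Qed.

Lemma induced_epi_overlaps (b : barc M) (c : barc N) :
  induced_epi f b c -> overlaps_above (bc_ivl b) (bc_ivl c).
Proof. by move=> /induced_epi_sub[]; exact: coincide_below_overlaps. Qed.

Definition epi_matching : overlap_matching (barc M) (barc N) :=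
  OverlapMatching induced_epi_functional induced_epi_injective
    induced_epi_overlaps.

(** Every element of the target is matched and composing with the matching discards no pair, so [g]
    is determined by the composite. *)
Lemma epi_matching_epi : @is_epi (Barc R) (barc M) (barc N) epi_matching.
Proof.
have sub (Z : barcode R) (g h : overlap_matching (barc N) Z) :
    om_comp g epi_matching = om_comp h epi_matching ->
    forall c z, g c z -> h c z.
  move=> gh c z gcz; have [b bc] := induced_epi_total c.
  have [rcb cb_sub] := induced_epi_sub bc.
  have : om_comp g epi_matching b z.
    split; first by exists c.
    exact: overlaps_above_subr (om_overlap gcz) rcb cb_sub.
  rewrite gh => -[[c' [bc' hc'z]] _].
  by rewrite (induced_epi_functional bc bc').
move=> Z g h gh; apply: overlap_matchingP => c z.
by split; apply: sub.
Qed.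

End Epi.

Lemma epi_matching_functor : exists X : forall M N : epi_cat (pfdmod R K),
    mor M N -> @mor (epi_cat (Barc R)) (barc M) (barc N),
  (forall M N (f : mor M N), omrel (sval (X M N f)) = induced_epi f) /\
  is_functor X.
Proof.
exists (fun M N f => exist _ (epi_matching f) (@epi_matching_epi M N f)).
split=> //; split=> [M|M N P g f]; apply: sval_injective;
  apply: overlap_matchingP => b c; split.
- exact: (induced_by_diag rP).
- by move=> ->; exact: (induced_by_refl rP).
(* Here the middle element comes from [c], since the second matching reaches all of its target. *)
- move=> bc; split; last exact: (@induced_epi_overlaps M P (cmor g f)).
  have [d dc] := induced_epi_total g c; exists d; split=> //.
  exact: (induced_by_trans rP bc (induced_by_sym dc)).
- by move=> [[d [bd dc]] _]; exact: (induced_by_trans rP bd dc).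
Qed.

End EpiMatching.

Theorem theorem1p1 (R : realType) (K : fieldType) :
  (exists X : forall M N : mono_cat (pfdmod R K), mor M N ->
                @mor (mono_cat (Barc R)) (barc M) (barc N),
     (forall M N (f : mor M N),
        omrel (sval (X M N f)) = induced_mono f) /\
     is_functor X)
  /\
  (exists X : forall M N : epi_cat (pfdmod R K), mor M N ->
                @mor (epi_cat (Barc R)) (barc M) (barc N),
     (forall M N (f : mor M N),
        omrel (sval (X M N f)) = induced_epi f) /\
     is_functor X).
Proof.
by split; [exact: mono_matching_functor|exact: epi_matching_functor].
Qed.
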